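(* There is a neighborhood $U\subset\mathbb{C}$ of $1$ with the following property. Let $x,y$ be complex numbers ($y\neq0$) such that the double series \[ A(x,y)=\sum_{n=0}^{\infty} x^n\binom{2n}{n}\sum_{k=0}^n\binom{n}{k}^2\binom{2k}{n}(-1)^k y^{2k-n} \] converges absolutely, and suppose there are $X,Y\in U$ with $X\neq Y$ such that \[ -xy=\left(\frac{X-Y}{4(1+XY)}\right)^2,\qquad 1+\frac{4x}{y}=\left[\frac{(X+Y)(1-XY)}{(X-Y)(1+XY)}\right]^2. \] Then \[ A(x,y)=\frac{1+XY}{2}\,{}_2F_1\!\left(\tfrac12,\tfrac12;1;1-X^2\right)\,{}_2F_1\!\left(\tfrac12,\tfrac12;1;1-Y^2\right). \]
   Context: $\binom{2k}{n}=0$ for $n>2k$; ${}_2F_1$ is the Gauss hypergeometric function. *)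

(* Defs.v *)
From HB Require Import structures.
From mathcomp Require Import all_boot all_order all_algebra.
From mathcomp Require Import complex.
From mathcomp Require Import all_classical all_reals all_analysis.
Set Implicit Arguments. Unset Strict Implicit. Unset Printing Implicit Defensive.
Import Order.TTheory GRing.Theory Num.Theory.
Import numFieldTopology.Exports numFieldNormedType.Exports.
Local Open Scope ring_scope.
Local Open Scope complex_scope.

(* Topology / normed structure on the complex numbers R[i]: the standard one
   induced by the complex modulus (copied from the generic numField instances). *)
HB.instance Definition _ (R : rcfType) :=
  PseudoPointedMetric.copy R[i] (R[i])^o.
HB.instance Definition _ (R : rcfType) := GRing.ComAlgebra.copy R[i] (R[i])^o.
HB.instance Definition _ (R : rcfType) := Vector.copy R[i] (R[i])^o.
HB.instance Definition _ (R : rcfType) := NormedModule.copy R[i] (R[i])^o.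

Definition poch {F : pzRingType} (a : F) (m : nat) : F :=
  \prod_(i < m) (a + i%:R).

Definition hyp2F1 {R : realType} (a b c z : R[i]) : R[i] :=
  limn (series (fun m : nat =>
          poch a m * poch b m / (poch c m * (m`!)%:R) * z ^+ m)).

(* The (n,k) term of the double series A(x,y):
   x^n C(2n,n) C(n,k)^2 C(2k,n) (-1)^k y^(2k-n)   (C(2k,n) = 0 for n > 2k). *)
Definition Aterm {R : realType} (x y : R[i]) (n k : nat) : R[i] :=
  x ^+ n * ('C(n.*2, n))%:R * (('C(n, k) ^ 2 * 'C(k.*2, n))%:R)
    * (-1) ^+ k * y ^ (k.*2%:Z - n%:Z).

Definition A_abs_conv {R : realType} (x y : R[i]) : Prop :=
  cvgn (series (fun n : nat => \sum_(k < n.+1) (`|Aterm x y n k| : R[i]))).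

Definition Aser {R : realType} (x y : R[i]) : R[i] :=
  limn (series (fun n : nat => \sum_(k < n.+1) Aterm x y n k)).

(* Main.v *)
Require Import Defs.
From HB Require Import structures.
From mathcomp Require Import all_boot all_order all_algebra.
From mathcomp Require Import complex.
From mathcomp Require Import all_classical all_reals all_analysis.
From mathcomp Require Import ring lra zify.
Set Implicit Arguments. Unset Strict Implicit. Unset Printing Implicit Defensive.
Import Order.TTheory GRing.Theory Num.Theory.
Import numFieldTopology.Exports numFieldNormedType.Exports.
Local Open Scope ring_scope.
Local Open Scope complex_scope.

(* In the variables u = xy and v = x^2 the series A is a power series F(u,v)
   whose coefficients satisfy two recurrences, i.e. F is annihilated by two
   second-order differential operators P1 and P2.  After the substitution of
   X and Y, the operator L = (X^3 - X) D^2 + (3 X^2 - 1) D + X, which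
   annihilates g(X) = 2F1(1/2,1/2;1;1-X^2), applied to h = F/(1+XY) is a
   combination of P1 F and P2 F, hence zero.  As h is regular at the singular
   point X = 1, a Wronskian argument gives h(X,Y) = h(1,Y) g(X), and by symmetry
   h(1,Y) = h(1,1) g(Y) with h(1,1) = 1/2.
   Termwise differentiation is avoided by running the argument on the
   partial sums: P1 and P2 then only leave boundary terms, which are O(2^-N)
   for X and Y close to 1. *)

(** * Complex-valued curves *)

(** The singular point X = 1 serves as base point because both exponents of L there are 0: the
    second solution is logarithmic, so regular solutions form a line and their value at X = 1
    determines them. L itself is Gauss's equation with parameters 1/2, 1/2; 1 after z = 1 - X^2. The
    two recurrences exist because the coefficient of u^m v^j is a quotient of factorials, so ratios
    of neighbouring coefficients are rational. A partial sum of the outer series is a cut by the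
    weighted degree m + 2j, and each recurrence fails only along the edge of this cut. There the
    crude growth 64^(m+2j) of the coefficients competes with |u|, |v| <= 2^-22, which holds for X
    and Y within 2^-12 of 1; what remains is at most a constant times N^4 32^-N, and N^4 <= 16^N. *)

(* Derivatives of complex-valued curves are taken componentwise, because R[i]
   is a normed module over itself but not over R. *)
Definition cderiv {R : realType} (f : R -> R[i]) (t : R) (l : R[i]) : Prop :=
  is_derive t 1 (fun s => complex.Re (f s)) (complex.Re l) /\
  is_derive t 1 (fun s => complex.Im (f s)) (complex.Im l).

Lemma cderiv_cst {R : realType} (c : R[i]) (t : R) : cderiv (fun=> c) t 0.
Proof. by split; exact: is_derive_cst. Qed.

Lemma ReM {R : realType} (a b : R[i]) :
  complex.Re (a * b) = complex.Re a * complex.Re b - complex.Im a * complex.Im b.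
Proof. by case: a => ? ?; case: b. Qed.

Lemma ImM {R : realType} (a b : R[i]) :
  complex.Im (a * b) = complex.Re a * complex.Im b + complex.Im a * complex.Re b.
Proof. by case: a => ? ?; case: b. Qed.

Lemma ReD {R : realType} (a b : R[i]) : complex.Re (a + b) = complex.Re a + complex.Re b.
Proof. by case: a => ? ?; case: b. Qed.

Lemma ImD {R : realType} (a b : R[i]) : complex.Im (a + b) = complex.Im a + complex.Im b.
Proof. by case: a => ? ?; case: b. Qed.

Lemma cderivD {R : realType} (f g : R -> R[i]) t a b :
  cderiv f t a -> cderiv g t b -> cderiv (fun s => f s + g s) t (a + b).
Proof.
move=> [f1 f2] [g1 g2]; split.
  have -> : (fun s => complex.Re (f s + g s)) =
      (fun s => complex.Re (f s)) + (fun s => complex.Re (g s)).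
    by apply/funext => s; rewrite ReD.
  rewrite ReD; exact: is_deriveD.
have -> : (fun s => complex.Im (f s + g s)) =
    (fun s => complex.Im (f s)) + (fun s => complex.Im (g s)).
  by apply/funext => s; rewrite ImD.
rewrite ImD; exact: is_deriveD.
Qed.

Lemma cderivM {R : realType} (f g : R -> R[i]) t a b :
  cderiv f t a -> cderiv g t b -> cderiv (fun s => f s * g s) t (a * g t + f t * b).
Proof.
move=> [f1 f2] [g1 g2]; split.
  have -> : (fun s => complex.Re (f s * g s)) =
     (fun s => complex.Re (f s)) * (fun s => complex.Re (g s))
     - (fun s => complex.Im (f s)) * (fun s => complex.Im (g s)).
    by apply/funext => s; rewrite ReM.
  apply: is_derive_eq (is_deriveB (is_deriveM f1 g1) (is_deriveM f2 g2)) _.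
  rewrite ReD (ReM a) (ReM (f t)) /GRing.scale /=; ring.
have -> : (fun s => complex.Im (f s * g s)) =
   (fun s => complex.Re (f s)) * (fun s => complex.Im (g s))
   + (fun s => complex.Im (f s)) * (fun s => complex.Re (g s)).
  by apply/funext => s; rewrite ImM.
apply: is_derive_eq (is_deriveD (is_deriveM f1 g2) (is_deriveM f2 g1)) _.
  rewrite ImD (ImM a) (ImM (f t)) /GRing.scale /=; ring.
Qed.

Lemma cderiv_RC {R : realType} (t : R) : cderiv (fun s : R => s%:C) t 1.
Proof. by split; [exact: is_derive_id|exact: is_derive_cst]. Qed.

Lemma cderivV {R : realType} (f : R -> R[i]) t a : f t != 0 ->
  cderiv f t a -> cderiv (fun s => (f s)^-1) t (- a / f t ^+ 2).
Proof.
move=> f0 [f1 f2].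
pose p := fun s => complex.Re (f s); pose q := fun s => complex.Im (f s).
(* [D] is the squared modulus: the inverse is the conjugate divided by [D], so the real rules for
   products and inverses suffice. *)
pose D := p ^+ 2 + q ^+ 2.
have DE s : D s = p s ^+ 2 + q s ^+ 2 by [].
have D0 : D t != 0.
  rewrite /D /p /q; apply: contraNneq f0 => /eqP.
  rewrite paddr_eq0 ?sqr_ge0// !sqrf_eq0 => /andP[A B].
  by rewrite eq_complex A B.
have dV : is_derive t 1 (fun s => (D s)^-1)
    (- (D t) ^- 2 * (2 * p t * complex.Re a + 2 * q t * complex.Im a)).
  have dD : is_derive t 1 D (2 * p t * complex.Re a + 2 * q t * complex.Im a).
    by apply: is_derive_eq (is_deriveD (is_deriveX 2 f1) (is_deriveX 2 f2)) _;
      rewrite /GRing.scale /= !expr1.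
  have dd : derivable D t 1 by case: dD.
  have := derivableP (derivableV D0 dd).
  by rewrite (deriveV D0 dd) derive_val /GRing.scale.
have -> : - a / f t ^+2 = - a * (f t)^-1 * (f t)^-1 by rewrite expr2 invfM mulrA.
have fV s : (f s)^-1 = (p s * (D s)^-1) +i* (- q s * (D s)^-1).
  by rewrite DE /p /q; case: (f s) => x y; rewrite /= mulNr.
split.
  have -> : (fun s => complex.Re (f s)^-1) = p * (fun s => (D s)^-1).
    by apply/funext => s; rewrite fV.
  apply: is_derive_eq (is_deriveM f1 dV) _.
  rewrite ?(ReM _ (f t)^-1) ?(ImM _ (f t)^-1) ?(ReM _ (f t)^-1) fV /= /GRing.scale /=.
  move: D0; rewrite DE /p /q; case: (f t) => x y.
  case: a {f1 f2 dV} => u v /= H.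
  by field.
have -> : (fun s => complex.Im (f s)^-1) = (- q) * (fun s => (D s)^-1).
  by apply/funext => s; rewrite fV.
apply: is_derive_eq (is_deriveM (is_deriveN f2) dV) _.
rewrite ?(ReM _ (f t)^-1) ?(ImM _ (f t)^-1) ?(ReM _ (f t)^-1) fV /= /GRing.scale /=.
move: D0; rewrite -[(- q) t]/(- q t) DE /p /q; case: (f t) => x y.
case: a {f1 f2 dV} => u v /= H.
by field.
Qed.

(* The R-valued modulus; `|z| takes its values in R[i]. *)
Local Notation nm := ComplexField.Normc.normc.

Lemma nmE {R : realType} (z : R[i]) : `|z| = (nm z)%:C.
Proof. by []. Qed.

Lemma nm_ge0 {R : realType} (z : R[i]) : 0 <= nm z.
Proof. by rewrite -(@ler0c R) -nmE. Qed.

Lemma nm0 {R : realType} : nm (0 : R[i]) = 0.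
Proof. exact: ComplexField.Normc.normc0. Qed.

Lemma nm1 {R : realType} : nm (1 : R[i]) = 1.
Proof. exact: ComplexField.Normc.normc1. Qed.

Lemma nmM {R : realType} (a b : R[i]) : nm (a * b) = nm a * nm b.
Proof. exact: ComplexField.Normc.normcM. Qed.

Lemma nmV {R : realType} (a : R[i]) : nm a^-1 = (nm a)^-1.
Proof. exact: ComplexField.Normc.normcV. Qed.

Lemma nmN {R : realType} (a : R[i]) : nm (- a) = nm a.
Proof. exact: normcN. Qed.

Lemma nmD {R : realType} (a b : R[i]) : nm (a + b) <= nm a + nm b.
Proof. exact: le_normcD. Qed.

Lemma nmX {R : realType} (a : R[i]) n : nm (a ^+ n) = nm a ^+ n.
Proof. by elim: n => [|n IH]; rewrite ?expr0 ?nm1// !exprS nmM IH. Qed.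

Lemma nmR {R : realType} (x : R) : 0 <= x -> nm x%:C = x.
Proof. by move=> x0; rewrite /= expr0n addr0 sqrtr_sqr ger0_norm. Qed.

Lemma nmn {R : realType} n : nm (n%:R : R[i]) = n%:R.
Proof. by rewrite -(nmR (ler0n R n)) rmorph_nat. Qed.

Lemma nm_sum {R : realType} (I : Type) (r : seq I) (P : pred I) (F : I -> R[i]) :
  nm (\sum_(i <- r | P i) F i) <= \sum_(i <- r | P i) nm (F i).
Proof.
elim/big_ind2: _ => [|x1 x2 y1 y2 h1 h2|//]; first by rewrite nm0.
exact: le_trans (nmD _ _) (lerD h1 h2).
Qed.

Lemma nm_eq0 {R : realType} (a : R[i]) : (nm a == 0) = (a == 0).
Proof.
by apply/eqP/eqP => [/ComplexField.Normc.eq0_normc//|->]; rewrite nm0.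
Qed.

Lemma nm_le_ReIm {R : realType} (z : R[i]) :
  nm z <= `|complex.Re z| + `|complex.Im z|.
Proof.
rewrite {1}[z]complexE; apply: le_trans (nmD _ _) _.
have nmRE x : nm (x%:C : R[i]) = `|x| by rewrite /= expr0n addr0 sqrtr_sqr.
by rewrite nmM !nmRE /= expr0n expr1n add0r sqrtr1 mul1r.
Qed.

Lemma Re_le_nm {R : realType} (z : R[i]) : `|complex.Re z| <= nm z.
Proof. by rewrite -(@lecR R) -nmE normc_ge_Re. Qed.

Lemma Im_le_nm {R : realType} (z : R[i]) : `|complex.Im z| <= nm z.
Proof.
have := Re_le_nm (z * 'i%C).
by rewrite ReiNIm normrN nmM /= expr0n expr1n add0r sqrtr1 mulr1.
Qed.

(** The mean value theorem has no complex form, so it is applied to real and imaginary parts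
    separately, at the cost of the factor 2. The derivative is bounded only for a < t, since the
    intermediate point is interior; this permits bounds obtained by dividing by a quantity that
    vanishes at the left end. *)
Lemma cderiv_bound {R : realType} (f l : R -> R[i]) (a b e : R) : a <= b ->
  (forall t, a <= t <= b -> cderiv f t (l t)) ->
  (forall t, a < t <= b -> nm (l t) <= e) ->
  nm (f b - f a) <= 2 * e * (b - a).
Proof.
rewrite le_eqVlt => /predU1P[<-|ab] df le.
  by rewrite !subrr nm0 mulr0.
have H (p : R[i] -> R) :
    (forall x y, p (x - y) = p x - p y) -> (forall z, `|p z| <= nm z) ->
    (forall t, a <= t <= b -> is_derive t 1 (fun s => p (f s)) (p (l t))) ->
    `|p (f b - f a)| <= e * (b - a).
  move=> pB pn pd.
  rewrite pB; have [t tab ->] : exists2 c, c \in `]a, b[%R &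
      p (f b) - p (f a) = p (l c) * (b - a).
    apply: (MVT ab (f := fun s => p (f s)) (df := fun s => p (l s))) => [t|].
      by rewrite in_itv /= => /andP[/ltW h1 /ltW h2]; apply: pd; rewrite h1.
    apply: derivable_within_continuous => t; rewrite in_itv /= => h.
    by case: (pd t h).
  move: tab; rewrite in_itv /= => /andP[h1 h2].
  rewrite normrM (ger0_norm (x := b - a)) ?subr_ge0 ?(ltW ab)//.
  rewrite ler_wpM2r ?subr_ge0 ?(ltW ab)//.
  by apply: le_trans (pn _) _; apply: le; rewrite h1 ltW.
apply: le_trans (nm_le_ReIm _) _.
rewrite -mulrA mulr_natl mulr2n; apply: lerD.
  apply: H => [[? ?] [? ?]//||t /df[]//]; exact: Re_le_nm.
apply: H => [[? ?] [? ?]//||t /df[]//]; exact: Im_le_nm.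
Qed.

Lemma cderiv_eq {R : realType} (f : R -> R[i]) t a b :
  cderiv f t a -> a = b -> cderiv f t b.
Proof. by move=> ? <-. Qed.

Lemma cderivN {R : realType} (f : R -> R[i]) t a :
  cderiv f t a -> cderiv (fun s => - f s) t (- a).
Proof.
move=> fa; have := cderivM (cderiv_cst (-1) t) fa.
rewrite mul0r add0r mulN1r.
rewrite (_ : (fun s => _ * _) = (fun s => - f s)) //.
by apply/funext => s; rewrite mulN1r.
Qed.

Lemma cderivB {R : realType} (f g : R -> R[i]) t a b :
  cderiv f t a -> cderiv g t b -> cderiv (fun s => f s - g s) t (a - b).
Proof. by move=> fa gb; apply: cderivD fa (cderivN gb). Qed.

Lemma cderivX {R : realType} (f : R -> R[i]) t a n :
  cderiv f t a -> cderiv (fun s => f s ^+ n) t (n%:R * f t ^+ n.-1 * a).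
Proof.
move=> fa; elim: n => [|n IH].
  by apply: cderiv_eq (cderiv_cst 1 t) _; rewrite !mul0r.
rewrite (_ : (fun s => _) = (fun s => f s * f s ^+ n)); last first.
  by apply/funext => s; rewrite exprS.
apply: cderiv_eq (cderivM fa IH) _; case: n {IH} => [|n] /=; first by rewrite expr0; ring.
by rewrite !exprS -!natr1; ring.
Qed.

Lemma cderiv_sum {R : realType} (I : Type) (r : seq I) (f : I -> R -> R[i]) t a :
  (forall i, cderiv (f i) t (a i)) ->
  cderiv (fun s => \sum_(i <- r) f i s) t (\sum_(i <- r) a i).
Proof.
move=> fa; elim: r => [|i r IH].
  rewrite big_nil (_ : (fun s => _) = (fun=> 0)); first exact: cderiv_cst.
  by apply/funext => s; rewrite big_nil.
rewrite big_cons (_ : (fun s => _) = (fun s => f i s + \sum_(j <- r) f j s)).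
  exact: cderivD.
by apply/funext => s; rewrite big_cons.
Qed.

Lemma cderiv_line {R : realType} (a d : R[i]) t :
  cderiv (fun s : R => a + s%:C * d) t d.
Proof.
apply: cderiv_eq (cderivD (cderiv_cst a t) (cderivM (cderiv_RC t) (cderiv_cst d t))) _.
by rewrite add0r mul1r mulr0 addr0.
Qed.

(** * A Wronskian estimate *)

Section Wronskian.
Variables (R : realType) (d : R[i]) (h h1 h2 g g1 g2 : R -> R[i]) (e B : R).
Let X (t : R) : R[i] := 1 + t%:C * d.
Let L (f f1 f2 : R -> R[i]) t :=
  (X t ^+ 3 - X t) * f2 t + (3 * X t ^+ 2 - 1) * f1 t + X t * f t.
Hypothesis nd : nm d <= 4^-1.
Hypothesis dh : forall t, 0 <= t <= 1 -> cderiv h t (d * h1 t).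
Hypothesis dh1 : forall t, 0 <= t <= 1 -> cderiv h1 t (d * h2 t).
Hypothesis dg : forall t, 0 <= t <= 1 -> cderiv g t (d * g1 t).
Hypothesis dg1 : forall t, 0 <= t <= 1 -> cderiv g1 t (d * g2 t).
Hypothesis Lh : forall t, 0 <= t <= 1 -> nm (L h h1 h2 t) <= e.
Hypothesis Lg : forall t, 0 <= t <= 1 -> nm (L g g1 g2 t) <= e.
Hypothesis hB : forall t, 0 <= t <= 1 -> nm (h t) <= B.
Hypothesis g_le : forall t, 0 <= t <= 1 -> nm (g t) <= 2.
Hypothesis g_ge : forall t, 0 <= t <= 1 -> 2^-1 <= nm (g t).

(* W is continuous across the singular point X = 1 of L, where it vanishes, and
   W' = g L h - h L g because the first-order terms of L complete W' to an exact
   derivative; finally (h / g)' = W / ((X^3 - X) g^2). *)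
Let W t := (X t ^+ 3 - X t) * (h1 t * g t - h t * g1 t).

Let dW t : 0 <= t <= 1 ->
  cderiv W t (d * (g t * L h h1 h2 t - h t * L g g1 g2 t)).
Proof.
move=> t01; have dX := cderiv_line 1 d t; rewrite -/X in dX.
apply: cderiv_eq (cderivM (cderivB (cderivX 3 dX) dX)
  (cderivB (cderivM (dh1 t01) (dg t01)) (cderivM (dh t01) (dg1 t01)))) _.
by rewrite /L /=; ring.
Qed.

Let e_ge0 : 0 <= e.
Proof. by apply: le_trans (nm_ge0 _) (Lh (t := 0) _); rewrite lexx ler01. Qed.

Let B_ge0 : 0 <= B.
Proof. by apply: le_trans (nm_ge0 _) (hB (t := 0) _); rewrite lexx ler01. Qed.

(** The factor [t] is what later cancels the simple zero of X^3 - X at the start of the segment. *)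
Let W_le t : 0 <= t <= 1 -> nm (W t) <= e * (2 + B) / 2 * t.
Proof.
move=> /andP[t0 t1].
have W0 : W 0 = 0 by rewrite /W /X mul0r addr0 expr1n subrr mul0r.
have -> : W t = W t - W 0 by rewrite W0 subr0.
(* [4^-1] bounds |d|; [2 * e] and [B * e] bound the two terms g L h and h L g of W'. *)
rewrite (_ : _ / 2 * t = 2 * (4^-1 * (2 * e + B * e)) * (t - 0)); last first.
  by field.
apply: cderiv_bound => // s /andP[s0 st].
  by apply: dW; rewrite s0 (le_trans st).
have s01 : 0 <= s <= 1 by rewrite ltW //= (le_trans st).
rewrite nmM; apply: ler_pM => //; [exact: nm_ge0|exact: nm_ge0|].
apply: le_trans (nmD _ _) _; rewrite nmN !nmM.
by apply: lerD; apply: ler_pM; rewrite ?nm_ge0 ?g_le ?Lh ?Lg ?hB.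
Qed.

(** A quantitative form of uniqueness: approximate solutions regular at X = 1 are proportional up to
    O(e). The derivative of h / g is at most e (2 + B) / 2 divided by 1/4, and [cderiv_bound]
    doubles this. *)
Lemma wronskian_bound : nm (h 1 / g 1 - h 0 / g 0) <= 4 * e * (2 + B).
Proof.
rewrite (_ : 4 * e * _ = 2 * (2 * e * (2 + B)) * (1 - 0)); last by ring.
have g0 t : 0 <= t <= 1 -> g t != 0.
  by move=> /g_ge; rewrite -nm_eq0; case: eqP => // ->; lra.
apply: (cderiv_bound (f := fun t => h t / g t)
  (l := fun t => d * (h1 t * g t - h t * g1 t) / g t ^+ 2)) => //.
  move=> t t01; apply: cderiv_eq (cderivM (dh t01) (cderivV (g0 t t01) (dg t01))) _.
  by have := g0 t t01 => gt0; field.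
move=> t /andP[t0 t1]; have t01 : 0 <= t <= 1 by rewrite ltW.
have := W_le t01; rewrite /W nmM.
(* Here X - 1 = t d. The [t] cancels against [W_le], while [d] is the chain-rule factor already
   present in the derivative of h / g; so nothing is ever divided by [d]. *)
have -> : X t ^+ 3 - X t = t%:C * (d * (X t * (X t + 1))).
  by rewrite /X; ring.
rewrite !nmM nmV nmX nmR ?(ltW t0)//.
set w := nm (_ - _) => Hw.
have td : nm (t%:C * d) <= 4^-1.
  rewrite nmM nmR ?(ltW t0)//; apply: le_trans nd.
  by rewrite ler_piMl ?nm_ge0.
have X1 : 3 / 4 <= nm (X t).
  have := nmD (X t) (- (t%:C * d)); rewrite /X addrK nmN nm1; lra.
have X2 : 7 / 4 <= nm (X t + 1).
  have := nmD (X t + 1) (- (t%:C * d)); rewrite nmN.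
  by rewrite (_ : X t + 1 - _ = 2%:R) ?nmn; [lra|rewrite /X; ring].
have XX : 1 <= nm (X t) * nm (X t + 1) by nra.
have gg : 4^-1 <= nm (g t) ^+ 2 by have := g_ge t01; nra.
have w0 : 0 <= w by exact: nm_ge0.
have dw : nm d * w <= e * (2 + B) / 2.
  move: Hw; set b := nm (X t) * _ in XX *; rewrite [leRHS]mulrC -mulrA ler_pM2l//.
  apply: le_trans; rewrite -subr_ge0.
  rewrite (_ : _ - _ = nm d * w * (b - 1)); last by ring.
  by rewrite mulr_ge0 ?mulr_ge0 ?nm_ge0// subr_ge0.
rewrite ler_pdivrMr; last by lra.
have := mulr_ge0 e_ge0 (addr_ge0 (ler0n _ 2) B_ge0).
set q := e * _ in dw *; rewrite -mulrA -/q => q0.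
apply: le_trans dw _; nra.
Qed.
End Wronskian.

(** * Polynomial truncations and their differential equations *)

(** The range is a plain square; the actual cut is put into the coefficients, so derivatives and
    index shifts never alter the range. *)
Definition dblsum {F : nzRingType} N (a : nat -> nat -> F) (u v : F) : F :=
  \sum_(m < N) \sum_(j < N) a m j * u ^+ m * v ^+ j.

Definition coef_du {F : nzRingType} (a : nat -> nat -> F) m j := m.+1%:R * a m.+1 j.
Definition coef_dv {F : nzRingType} (a : nat -> nat -> F) m j := j.+1%:R * a m j.+1.

Lemma eq_dblsum {F : nzRingType} N (a b : nat -> nat -> F) u v :
  (forall m j, a m j = b m j) -> dblsum N a u v = dblsum N b u v.
Proof. by move=> ab; apply: eq_bigr => m _; apply: eq_bigr => j _; rewrite ab. Qed.

Lemma sum_ord_shift {V : nmodType} N (f : nat -> V) : f 0%N = 0 -> f N = 0 ->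
  \sum_(m < N) f m.+1 = \sum_(m < N) f m.
Proof.
move=> f0 fN; transitivity (\sum_(m < N.+1) f m).
  by rewrite big_ord_recl f0 add0r.
by rewrite big_ord_recr /= fN addr0.
Qed.

Lemma dblsum_shiftl {F : comNzRingType} N (b : nat -> nat -> F) u v :
  (forall j, b 0%N j = 0) -> (forall j, b N j = 0) ->
  u * dblsum N (fun m j => b m.+1 j) u v = dblsum N b u v.
Proof.
move=> b0 bN; rewrite /dblsum mulr_sumr.
rewrite -[RHS](@sum_ord_shift _ N (fun m => \sum_(j < N) b m j * u ^+ m * v ^+ j)).
- apply: eq_bigr => m _; rewrite mulr_sumr; apply: eq_bigr => j _.
  by rewrite exprS; ring.
- by apply: big1 => j _; rewrite b0 !mul0r.
- by apply: big1 => j _; rewrite bN !mul0r.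
Qed.

Lemma dblsum_shiftr {F : comNzRingType} N (b : nat -> nat -> F) u v :
  (forall m, b m 0%N = 0) -> (forall m, b m N = 0) ->
  v * dblsum N (fun m j => b m j.+1) u v = dblsum N b u v.
Proof.
move=> b0 bN; rewrite /dblsum mulr_sumr; apply: eq_bigr => m _.
rewrite -[RHS](@sum_ord_shift _ N (fun j => b m j * u ^+ m * v ^+ j)).
- by rewrite mulr_sumr; apply: eq_bigr => j _; rewrite exprS; ring.
- by rewrite b0 !mul0r.
- by rewrite bN !mul0r.
Qed.

Section Pde.
Variables (F : comNzRingType) (N : nat) (a : nat -> nat -> F) (u v : F).
Hypothesis aNl : forall m j, (N <= m)%N -> a m j = 0.
Hypothesis aNr : forall m j, (N <= j)%N -> a m j = 0.
Let P b := dblsum N b u v.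

Let PD b c : P b + P c = P (fun m j => b m j + c m j).
Proof.
rewrite /P /dblsum -big_split; apply: eq_bigr => m _.
by rewrite -big_split; apply: eq_bigr => j _; rewrite !mulrDl.
Qed.

Let PZ x b : x * P b = P (fun m j => x * b m j).
Proof.
rewrite /P /dblsum mulr_sumr; apply: eq_bigr => m _.
by rewrite mulr_sumr; apply: eq_bigr => j _; rewrite !mulrA.
Qed.

Let Pu : u * P (coef_du a) = P (fun m j => m%:R * a m j).
Proof.
rewrite -[RHS]dblsum_shiftl // => j; first by rewrite mul0r.
by rewrite aNl ?mulr0.
Qed.

Let Pv : v * P (coef_dv a) = P (fun m j => j%:R * a m j).
Proof.
rewrite -[RHS]dblsum_shiftr // => j; first by rewrite mul0r.
by rewrite aNr ?mulr0.
Qed.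

Let Puu : u * P (coef_du (coef_du a)) = P (fun m j => m%:R * m.+1%:R * a m.+1 j).
Proof.
rewrite -[RHS]dblsum_shiftl => [||j]; first 2 last.
- by rewrite aNl ?mulr0.
- by congr (_ * _); apply: eq_dblsum => m j; rewrite /coef_du mulrA.
- by move=> j; rewrite !mul0r.
Qed.

Let Pu2 : u ^+ 2 * P (coef_du (coef_du a)) = P (fun m j => m%:R * (m%:R - 1) * a m j).
Proof.
rewrite expr2 -mulrA Puu -[RHS]dblsum_shiftl => [||j]; first 2 last.
- by rewrite aNl ?mulr0.
- by congr (_ * _); apply: eq_dblsum => m j; rewrite -natr1; ring.
- by move=> j; rewrite !mul0r.
Qed.

Let Pvv : v * P (coef_dv (coef_dv a)) = P (fun m j => j%:R * j.+1%:R * a m j.+1).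
Proof.
rewrite -[RHS]dblsum_shiftr => [||j]; first 2 last.
- by rewrite aNr ?mulr0.
- by congr (_ * _); apply: eq_dblsum => m j; rewrite /coef_dv mulrA.
- by move=> j; rewrite !mul0r.
Qed.

Let Pv2 : v ^+ 2 * P (coef_dv (coef_dv a)) = P (fun m j => j%:R * (j%:R - 1) * a m j).
Proof.
rewrite expr2 -mulrA Pvv -[RHS]dblsum_shiftr => [||j]; first 2 last.
- by rewrite aNr ?mulr0.
- by congr (_ * _); apply: eq_dblsum => m j; rewrite -natr1; ring.
- by move=> j; rewrite !mul0r.
Qed.

Let Puv : v * P (coef_du (coef_dv a)) = P (fun m j => j%:R * m.+1%:R * a m.+1 j).
Proof.
rewrite -[RHS]dblsum_shiftr => [||j]; first 2 last.
- by rewrite aNr ?mulr0.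
- by congr (_ * _); apply: eq_dblsum => m j; rewrite /coef_dv /coef_du; ring.
- by move=> j; rewrite !mul0r.
Qed.

Let Puv2 : u * v * P (coef_du (coef_dv a)) = P (fun m j => m%:R * j%:R * a m j).
Proof.
rewrite -mulrA Puv -[RHS]dblsum_shiftl => [||j]; first 2 last.
- by rewrite aNl ?mulr0.
- by congr (_ * _); apply: eq_dblsum => m j; ring.
- by move=> j; rewrite !mul0r.
Qed.

(** With the Euler operators theta_u = u d/du and theta_v = v d/dv, the left side is d/du (theta_u +
    theta_v) + 4 (2 theta_u + 2 theta_v + 1)(2 theta_u + 4 theta_v + 1), and an Euler operator
    multiplies each coefficient by its index. The right side is the defect of [Auv_recl]. *)
Lemma dblsum_pde1 :
  u * P (coef_du (coef_du a)) + v * P (coef_du (coef_dv a)) + P (coef_du a)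
  + 4 * (4 * u ^+ 2 * P (coef_du (coef_du a)) + 12 * u * v * P (coef_du (coef_dv a))
         + 8 * v ^+ 2 * P (coef_dv (coef_dv a)) + 8 * u * P (coef_du a) + 14 * v * P (coef_dv a)
         + P a)
  = P (fun m j => m.+1%:R * (m + j).+1%:R * a m.+1 j
     + 4 * (2 * m + 2 * j).+1%:R * (2 * m + 4 * j).+1%:R * a m j).
Proof.
transitivity (u * P (coef_du (coef_du a)) + v * P (coef_du (coef_dv a)) + P (coef_du a)
  + (16 * (u ^+ 2 * P (coef_du (coef_du a))) + 48 * (u * v * P (coef_du (coef_dv a)))
     + 32 * (v ^+ 2 * P (coef_dv (coef_dv a))) + 32 * (u * P (coef_du a))
     + 56 * (v * P (coef_dv a))
     + 4 * P a)); first by ring.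
rewrite Puu Puv Pu2 Puv2 Pv2 Pu Pv.
rewrite !(PZ, PD); apply: eq_dblsum => m j.
by rewrite /coef_du -!natr1 !(natrD, natrM); ring.
Qed.

(** Here the operator is d/dv theta_v - 2 (2 theta_u + 4 theta_v + 3) d/du, and the right side is
    the defect of [Auv_recr]. *)
Lemma dblsum_pde2 :
  v * P (coef_dv (coef_dv a)) + P (coef_dv a)
  - 4 * u * P (coef_du (coef_du a)) - 8 * v * P (coef_du (coef_dv a))
  - 6 * P (coef_du a)
  = P (fun m j => j.+1%:R ^+ 2 * a m j.+1
     - 2 * (2 * m + 4 * j + 3)%:R * m.+1%:R * a m.+1 j).
Proof.
transitivity (v * P (coef_dv (coef_dv a)) + P (coef_dv a) + - 4 * (u * P (coef_du (coef_du a)))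
  + - 8 * (v * P (coef_du (coef_dv a))) + - 6 * P (coef_du a)); first by ring.
rewrite Puu Puv Pvv.
rewrite !(PZ, PD); apply: eq_dblsum => m j.
by rewrite /coef_du /coef_dv -!natr1 !(natrD, natrM); ring.
Qed.
End Pde.

Lemma cderiv_dblsum {R : realType} N (a : nat -> nat -> R[i]) (u v : R -> R[i]) t u' v' :
  (forall m j, (N <= m)%N -> a m j = 0) -> (forall m j, (N <= j)%N -> a m j = 0) ->
  cderiv u t u' -> cderiv v t v' ->
  cderiv (fun s => dblsum N a (u s) (v s)) t
    (dblsum N (coef_du a) (u t) (v t) * u' + dblsum N (coef_dv a) (u t) (v t) * v').
Proof.
move=> aNl aNr du' dv'; rewrite /dblsum.
have D : cderiv (fun s => \sum_(m < N) \sum_(j < N) a m j * u s ^+ m * v s ^+ j) t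
  (\sum_(m < N) \sum_(j < N) (m%:R * a m j * u t ^+ m.-1 * v t ^+ j * u'
     + j%:R * a m j * u t ^+ m * v t ^+ j.-1 * v')).
  apply: cderiv_sum => m; apply: cderiv_sum => j.
  apply: cderiv_eq (cderivM (cderivM (cderiv_cst _ _) (cderivX m du')) (cderivX j dv')) _.
  by ring.
apply: cderiv_eq D _.
under eq_bigr do rewrite big_split.
rewrite big_split /=; congr (_ + _).
  rewrite -(@sum_ord_shift _ N (fun m =>
    \sum_(j < N) m%:R * a m j * u t ^+ m.-1 * v t ^+ j * u')).
  - rewrite mulr_suml; apply: eq_bigr => m _; rewrite mulr_suml.
    by apply: eq_bigr => j _; rewrite /coef_du.
  - by apply: big1 => j _; rewrite !mul0r.
  - by apply: big1 => j _; rewrite aNl // mulr0 !mul0r.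
rewrite mulr_suml; apply: eq_bigr => m _; rewrite mulr_suml.
rewrite -(@sum_ord_shift _ N (fun j => j%:R * a m j * u t ^+ m * v t ^+ j.-1 * v')) //.
- by rewrite !mul0r.
- by rewrite aNr // mulr0 !mul0r.
Qed.

(** * Single sums and the Gauss operator *)

Definition sglsum {F : nzRingType} N (a : nat -> F) (z : F) : F :=
  \sum_(n < N) a n * z ^+ n.

Definition coef_dz {F : nzRingType} (a : nat -> F) n := n.+1%:R * a n.+1.

Lemma eq_sglsum {F : nzRingType} N (a b : nat -> F) z :
  a =1 b -> sglsum N a z = sglsum N b z.
Proof. by move=> ab; apply: eq_bigr => n _; rewrite ab. Qed.

Lemma sglsum_shift {F : comNzRingType} N (b : nat -> F) z :
  b 0%N = 0 -> b N = 0 -> z * sglsum N (fun n => b n.+1) z = sglsum N b z.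
Proof.
move=> b0 bN; rewrite /sglsum -[RHS](@sum_ord_shift _ N (fun n => b n * z ^+ n)).
- by rewrite mulr_sumr; apply: eq_bigr => n _; rewrite exprS; ring.
- by rewrite b0 !mul0r.
- by rewrite bN !mul0r.
Qed.

(** The left side is Gauss's operator with parameters 1/2, 1/2; 1. Coefficientwise it leaves the
    defect of [gauss_coef_rec], with (n + 1/2)^2 expanded. *)
Lemma sglsum_ode {F : fieldType} N (a : nat -> F) (z : F) :
  (forall n, (N <= n)%N -> a n = 0) ->
  z * (1 - z) * sglsum N (coef_dz (coef_dz a)) z + (1 - 2 * z) * sglsum N (coef_dz a) z
    - 4^-1 * sglsum N a z
  = sglsum N (fun n => n.+1%:R ^+ 2 * a n.+1
                       - (n%:R ^+ 2 + n%:R + 4^-1) * a n) z.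
Proof.
move=> aN.
have H1 : z * sglsum N (coef_dz a) z = sglsum N (fun n => n%:R * a n) z.
  by rewrite -[RHS]sglsum_shift ?mul0r// aN ?mulr0.
have H2 : z * sglsum N (coef_dz (coef_dz a)) z
    = sglsum N (fun n => n%:R * n.+1%:R * a n.+1) z.
  rewrite -[RHS]sglsum_shift ?mul0r// ?aN ?mulr0//.
  by congr (_ * _); apply: eq_sglsum => n; rewrite /coef_dz mulrA.
have H3 : z * (z * sglsum N (coef_dz (coef_dz a)) z)
    = sglsum N (fun n => n%:R * (n%:R - 1) * a n) z.
  rewrite H2 -[RHS]sglsum_shift ?mul0r// ?aN ?mulr0//.
  by congr (_ * _); apply: eq_sglsum => n; rewrite -natr1; ring.
transitivity (z * sglsum N (coef_dz (coef_dz a)) z - z * (z * sglsum N (coef_dz (coef_dz a)) z)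
  + sglsum N (coef_dz a) z - 2 * (z * sglsum N (coef_dz a) z) - 4^-1 * sglsum N a z).
  by ring.
rewrite H3 H2 H1 /sglsum !mulr_sumr -!sumrN -!big_split /=.
by apply: eq_bigr => n _; rewrite /coef_dz -natr1; ring.
Qed.

Lemma cderiv_sglsum {R : realType} N (a : nat -> R[i]) (z : R -> R[i]) t z' :
  (forall n, (N <= n)%N -> a n = 0) -> cderiv z t z' ->
  cderiv (fun s => sglsum N a (z s)) t (sglsum N (coef_dz a) (z t) * z').
Proof.
move=> aN dz'; rewrite /sglsum.
have D : cderiv (fun s => \sum_(n < N) a n * z s ^+ n) t
    (\sum_(n < N) n%:R * a n * z t ^+ n.-1 * z').
  apply: cderiv_sum => n.
  by apply: cderiv_eq (cderivM (cderiv_cst _ _) (cderivX n dz')) _; ring.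
apply: cderiv_eq D _; rewrite mulr_suml.
rewrite -(@sum_ord_shift _ N (fun n => n%:R * a n * z t ^+ n.-1 * z')) ?mul0r//.
by rewrite aN // mulr0 !mul0r.
Qed.

(** * The coefficients of the double series *)

Definition Acoef n k := ('C(n.*2, n) * ('C(n, k) ^ 2 * 'C(k.*2, n)))%N.

(** With k = m + j and n = m + 2j one has n - k = j and 2k - n = m, so the binomials become
    factorials of the indices. The (n!)^2 in the numerator of C(n,k)^2 cancels the one in the
    denominator of C(2n,n). *)
Lemma Acoef_fact m j :
  (Acoef (m + j.*2) (m + j) * ((m + j)`! ^ 2 * j`! ^ 2 * (m`! * (m + j.*2)`!))
   = (m + j).*2`! * (m + j.*2).*2`!)%N.
Proof.
set n := (m + j.*2)%N; set k := (m + j)%N.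
have H1 : ('C(n.*2, n) * (n`! * n`!) = n.*2`!)%N.
  by rewrite -(bin_fact (m := n) (n := n.*2)) -addnn ?leq_addr// addnK.
have H2 : ('C(n, k) * (k`! * j`!) = n`!)%N.
  by rewrite -(bin_fact (m := k) (n := n)); [congr (_ * (_ * _`!))%N|]; rewrite /n /k; lia.
have H3 : ('C(k.*2, n) * (n`! * m`!) = k.*2`!)%N.
  by rewrite -(bin_fact (m := n) (n := k.*2)); [congr (_ * (_ * _`!))%N|]; rewrite /n /k; lia.
have p : (0 < n`! ^ 2)%N by rewrite expn_gt0 fact_gt0.
apply/eqP; rewrite -(eqn_pmul2r p); apply/eqP; rewrite /Acoef -H1 -H3.
transitivity ('C(n.*2, n) * 'C(k.*2, n) * n`! ^ 3 * m`! * ('C(n, k) * (k`! * j`!)) ^ 2)%N.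
  by ring.
by rewrite H2; ring.
Qed.

(* Coefficient of u^m v^j in A(x,y), where u = xy, v = x^2; the n and k of the
   original double series are n = m + 2j and k = m + j. *)
Definition Auv {F : nzRingType} m j : F :=
  (-1) ^+ (m + j) * (Acoef (m + j.*2) (m + j))%:R.

Lemma AuvE {F : numFieldType} m j :
  Auv m j = (-1) ^+ (m + j) * (m + j).*2`!%:R * (m + j.*2).*2`!%:R
    / ((m + j)`!%:R ^+ 2 * j`!%:R ^+ 2 * (m`!%:R * (m + j.*2)`!%:R)) :> F.
Proof.
have f0 n : n`!%:R != 0 :> F by rewrite pnatr_eq0 -lt0n fact_gt0.
rewrite /Auv; apply: (canRL (mulfK _)).
  by rewrite !mulf_neq0 ?expf_neq0.
have := congr1 (fun n => n%:R : F) (Acoef_fact m j).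
set A := Acoef _ _; rewrite /= -mulnn -[(j`! ^ 2)%N]mulnn !natrM => E.
by rewrite -[RHS]mulrA -E; ring.
Qed.

(** Raising m by 1 raises both n and k by 1. In the quotient of the closed forms the even factors 2n
    + 2 and 2k + 2 cancel against n + 1 and k + 1, which leaves 4 and the two odd factors. *)
Lemma Auv_recl {F : numFieldType} m j :
  m.+1%:R * (m + j).+1%:R * Auv m.+1 j
    = - (4 * (2 * m + 2 * j).+1%:R * (2 * m + 4 * j).+1%:R * Auv m j) :> F.
Proof.
have f0 n : n`!%:R != 0 :> F by rewrite pnatr_eq0 -lt0n fact_gt0.
have s0 n : n.+1%:R != 0 :> F by rewrite pnatr_eq0.
rewrite !AuvE !addSn !doubleS !factS !natrM exprS.
rewrite (_ : (2 * m + 2 * j).+1 = (m + j).*2.+1) ; last by lia.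
rewrite (_ : (2 * m + 4 * j).+1 = (m + j.*2).*2.+1); last by lia.
move: (f0 m) (f0 j) (f0 (m + j)%N) (f0 (m + j.*2)%N) (s0 m) (s0 (m + j)%N) (s0 (m + j.*2)%N).
set A := (m + j).*2`!; set B := (m + j.*2).*2`!.
set p := (m + j)`!; set q := (m + j.*2)`!.
rewrite -!muln2.
set K := (m + j)%N. set n := (m + j * 2)%N.
rewrite -!natr1 !natrM => *.
by field; do !(apply/andP; split).
Qed.

(** Both coefficients have the same k = m + j + 1, so the sign and the factorials of k cancel; only
    n changes, from m + 2j + 1 to m + 2j + 2. *)
Lemma Auv_recr {F : numFieldType} m j :
  j.+1%:R ^+ 2 * Auv m j.+1
    = 2 * (2 * m + 4 * j + 3)%:R * m.+1%:R * Auv m.+1 j :> F.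
Proof.
have f0 n : n`!%:R != 0 :> F by rewrite pnatr_eq0 -lt0n fact_gt0.
have s0 n : n.+1%:R != 0 :> F by rewrite pnatr_eq0.
rewrite (_ : (2 * m + 4 * j + 3) = (m + j.*2).*2.+3)%N; last by lia.
rewrite !AuvE !(addSn, addnS, doubleS).
rewrite !(factS (m + j.*2).*2.+3) !(factS (m + j.*2).*2.+2) !(factS (m + j.*2).+1).
rewrite !(factS j) (factS m) !natrM.
move: (f0 m) (f0 j) (f0 (m + j).+1) (f0 (m + j.*2).+1) (s0 m) (s0 j) (s0 (m + j.*2).+1).
set A := (m + j).*2.+2`!; set B := (m + j.*2).*2.+2`!.
set p := (m + j).+1`!; set q := (m + j.*2).+1`!.
rewrite -!muln2.
set n := (m + j * 2)%N.
rewrite -!natr1 !natrM => *.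
by field; do !(apply/andP; split).
Qed.

Lemma bin_le_expn n k : ('C(n, k) <= 2 ^ n)%N.
Proof.
elim: n k => [|n IH] [|k] //; first by rewrite bin0 expn_gt0.
by rewrite binS expnS mul2n -addnn leq_add.
Qed.

(** Each of C(2n,n), C(n,k)^2 and C(2k,n) is at most 4^n, and 4^3 = 64. *)
Lemma Acoef_le n k : (k <= n)%N -> (Acoef n k <= 64 ^ n)%N.
Proof.
move=> kn; rewrite /Acoef (_ : 64 = 4 * (4 * 4))%N // !expnMn.
have H a b : ('C(a.*2, b) <= 4 ^ a)%N by rewrite -(expnM 2 2) mul2n bin_le_expn.
apply: leq_mul; first exact: H.
apply: leq_mul.
  by rewrite -(expnM 2 2) mulnC expnM leq_exp2r ?bin_le_expn.
by apply: leq_trans (H k n) _; rewrite leq_exp2l.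
Qed.

(** Since n = m + 2j, this cut keeps exactly the terms with n < N, so it reproduces the partial sums
    in [Aser]. *)
Definition truncate2 {F : nzRingType} N (a : nat -> nat -> F) m j :=
  if (m + j.*2 < N)%N then a m j else 0.

Lemma Aterm_Auv {R : realType} (x y : R[i]) n k : y != 0 -> (k <= n)%N ->
  (n <= k.*2)%N -> Aterm x y n k =
  Auv (k.*2 - n) (n - k) * (x * y) ^+ (k.*2 - n) * (x ^+ 2) ^+ (n - k).
Proof.
move=> y0 kn nk; rewrite /Aterm /Auv.
rewrite subzn // -exprnP.
rewrite (_ : k.*2 - n + (n - k) = k)%N; last by lia.
rewrite (_ : k.*2 - n + (n - k).*2 = n)%N; last by lia.
rewrite /Acoef natrM exprMn -exprM.
rewrite -{1}(_ : (k.*2 - n) + 2 * (n - k) = n)%N; last by lia.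
by rewrite exprD; ring.
Qed.

(** The substitution is j = n - k, m = 2k - n; the hypothesis removes the pairs for which m would be
    negative. The intermediate form is a sum over n and j with 2j <= n. *)
Lemma sum_square_triangle {V : nmodType} N (f : nat -> nat -> V) :
  (forall n k, (k.*2 < n)%N -> f n k = 0) ->
  \sum_(0 <= n < N) \sum_(k < n.+1) f n k =
  \sum_(m < N) \sum_(j < N | (m + j.*2 < N)%N) f (m + j.*2)%N (m + j)%N.
Proof.
move=> f0; rewrite (exchange_big_dep predT) //=.
transitivity (\sum_(0 <= n < N) \sum_(j < N | (j.*2 <= n)%N) f n (n - j)%N).
  rewrite !big_nat; apply: eq_bigr => n /= nN.
  rewrite -(big_mkord (fun j => j.*2 <= n)%N (fun j => f n (n - j)%N)).
  rewrite (big_cat_nat _ (n := n.+1)) //= [X in _ + X]big_nat_cond [X in _ + X]big1 ?addr0; last first.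
    by move=> j; lia.
  rewrite -(big_mkord predT (f n)) big_nat_rev /= add0n big_mkcond [RHS]big_mkcond /=.
  apply: eq_big_nat => j jn; rewrite subSS; case: ifP => // jn'.
  by apply: f0; lia.
rewrite (exchange_big_dep predT) //=; apply: eq_bigr => j _.
rewrite -(big_mkord (fun m => m + j.*2 < N)%N (fun m => f (m + j.*2)%N (m + j)%N)).
have [jN|jN] := leqP j.*2 N; last first.
  rewrite [LHS]big_nat_cond [LHS]big1; last by move=> i; lia.
  by rewrite [RHS]big_nat_cond [RHS]big1 // => i; lia.
rewrite (big_cat_nat _ (n := j.*2)) //= big_nat_cond big1 ?add0r; last by move=> i; lia.
rewrite -{1}(add0n j.*2) big_addn [RHS](big_cat_nat _ (n := (N - j.*2)%N)) ?leq_subr //=.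
rewrite [X in _ = _ + X]big_nat_cond [X in _ = _ + X]big1 ?addr0; last by move=> i; lia.
rewrite big_nat_cond [RHS]big_nat_cond; apply: eq_big => [m|m mj]; first lia.
by congr (f _ _); lia.
Qed.

Lemma Aser_partial {R : realType} (x y : R[i]) N : y != 0 ->
  series (fun n => \sum_(k < n.+1) Aterm x y n k) N =
  dblsum N (truncate2 N Auv) (x * y) (x ^+ 2).
Proof.
move=> y0; rewrite /series /= sum_square_triangle; last first.
  by move=> n k nk; rewrite /Aterm (bin_small nk) muln0 mulr0 !mul0r.
apply: eq_bigr => m _; rewrite big_mkcond /=; apply: eq_bigr => j _.
rewrite /truncate2; case: ifP => // h; last by rewrite !mul0r.
rewrite Aterm_Auv //; try lia.
rewrite (_ : (m + j).*2 - (m + j.*2) = m)%N; last by lia.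
by rewrite (_ : (m + j.*2) - (m + j) = j)%N; last by lia.
Qed.

(** * Truncation errors *)

Section Bounds.
Variable R : realType.
Implicit Types (u v z X Y : R[i]).

Lemma nm_Auv_le m j : nm (Auv m j : R[i]) <= 64 ^+ (m + j.*2).
Proof.
rewrite /Auv nmM nmX nmN nm1 expr1n mul1r nmn -natrX ler_nat.
by apply: Acoef_le; lia.
Qed.

(* 2^-22 = rho^2 with 64 rho = 1/32, where 64 bounds the growth rate of Auv. *)
Lemma Auv_term_le m j u v : nm u <= 2^-1 ^+ 22 -> nm v <= 2^-1 ^+ 22 ->
  64 ^+ (m + j.*2) * nm u ^+ m * nm v ^+ j <= (32^-1 : R) ^+ (m + j.*2).
Proof.
move=> hu hv; rewrite !exprD -!mul2n !exprM.
rewrite [leLHS](_ : _ = (64 * nm u) ^+ m * (64 ^+ 2 * nm v) ^+ j); last first.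
  by move: (64 ^+ 2) => c; rewrite (exprMn m) (exprMn j) mulrACA mulrA.
apply: ler_pM; rewrite ?exprn_ge0 ?mulr_ge0 ?nm_ge0 ?exprn_ge0//.
  by apply: lerXn2r; rewrite ?nnegrE ?mulr_ge0 ?nm_ge0//; lra.
apply: lerXn2r; rewrite ?nnegrE ?mulr_ge0 ?nm_ge0 ?exprn_ge0 //; lra.
Qed.

Lemma nm_dblsum_le N (a : nat -> nat -> R[i]) u v e :
  (forall m j, (m < N)%N -> (j < N)%N -> nm (a m j) * nm u ^+ m * nm v ^+ j <= e) ->
  nm (dblsum N a u v) <= N%:R ^+ 2 * e.
Proof.
move=> H; apply: le_trans (nm_sum _ _ _) _.
have C (f : 'I_N -> R) c : (forall i, f i <= c) -> \sum_(i < N) f i <= N%:R * c.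
  move=> fc; apply: le_trans (ler_sum _ (fun i _ => fc i)) _.
  by rewrite sumr_const card_ord mulr_natl.
rewrite expr2 -mulrA; apply: (C) => m; apply: le_trans (nm_sum _ _ _) _.
by apply: C => j; rewrite !nmM !nmX H.
Qed.

(** N^2 terms and a factor N^2 from the recurrence coefficients produce N^4; since N < 2^N it is at
    most 16^N, and 32 = 16 * 2. *)
Lemma expn4_le N : (N%:R ^+ 4 * 32^-1 ^+ N : R) <= 2^-1 ^+ N.
Proof.
have -> : (2^-1 : R) = 16 * 32^-1 by lra.
rewrite exprMn ler_wpM2r ?exprn_ge0 //.
rewrite (_ : 16 = 2 ^+ 4); last by lra.
by rewrite exprAC lerXn2r ?nnegrE ?exprn_ge0// -natrX ler_nat ltnW // ltn_expl.
Qed.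

(** A defect survives only where the cut separates the two indices of the recurrence, that is for m
    + 2j = N - 1; the single remaining term is geometrically small. The constant 2^18 is dictated by
    [pde2_coef_le]. *)
Lemma pde1_coef_le N m j u v : nm u <= 2^-1 ^+ 22 -> nm v <= 2^-1 ^+ 22 ->
  nm (m.+1%:R * (m + j).+1%:R * truncate2 N Auv m.+1 j
     + 4 * (2 * m + 2 * j).+1%:R * (2 * m + 4 * j).+1%:R * truncate2 N Auv m j : R[i])
  * nm u ^+ m * nm v ^+ j <= 2 ^+ 18 * N%:R ^+ 2 * 32^-1 ^+ N.
Proof.
move=> hu hv.
have p0 : 0 <= 2 ^+ 18 * N%:R ^+ 2 * 32^-1 ^+ N :> R.
  by rewrite !mulr_ge0 ?exprn_ge0.
rewrite /truncate2; case: ifP => h1.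
  rewrite Auv_recl (_ : (m + j.*2 < N)%N); last by lia.
  by rewrite addNr nm0 !mul0r.
case: ifP => h2; last by rewrite !mulr0 addr0 nm0 !mul0r.
have NE : N = (m + j.*2).+1 by lia.
move: (Auv m j) (nm_Auv_le m j) => c hc; rewrite mulr0 add0r !nmM !nmn.
have A1 : (2 * m + 2 * j).+1%:R <= 2 * N%:R :> R by rewrite -natrM ler_nat; lia.
have A2 : (2 * m + 4 * j).+1%:R <= 2 * N%:R :> R by rewrite -natrM ler_nat; lia.
apply: le_trans (_ : (4 * (2 * N%:R) * (2 * N%:R)) *
   (64 ^+ (m + j.*2) * nm u ^+ m * nm v ^+ j) <= _).
  rewrite !mulrA; do 2 (apply: ler_wpM2r; first by rewrite exprn_ge0 ?nm_ge0).
  apply: (ler_pM _ (nm_ge0 _) _ hc); first by rewrite !mulr_ge0.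
  rewrite (_ : 4 * 2 * N%:R * 2 * N%:R = 4 * (2 * N%:R) * (2 * N%:R)); last by ring.
  by apply: ler_pM; rewrite ?mulr_ge0 // ler_pM2l.
apply: le_trans (ler_wpM2l _ (Auv_term_le m j hu hv)) _; first by rewrite !mulr_ge0.
rewrite (_ : 32^-1 ^+ N = 32^-1 * 32^-1 ^+ (m + j.*2)); last by rewrite -exprS -NE.
set q := _ ^+ (m + _); have q0 : 0 <= q by rewrite exprn_ge0.
rewrite -subr_ge0 (_ : _ - _ = N%:R ^+ 2 * q * (2 ^+ 18 / 32 - 16)); last by field.
by rewrite !mulr_ge0 ?exprn_ge0//; lra.
Qed.

(** The cut separates the two indices only for m + 2j = N - 2. The surviving coefficient has weight
    one more than its monomial, which costs an extra 64: hence 2 * 2 * 64 = 256, and with two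
    missing factors 1/32 the constant 256 * 32^2 = 2^18. *)
Lemma pde2_coef_le N m j u v : nm u <= 2^-1 ^+ 22 -> nm v <= 2^-1 ^+ 22 ->
  nm (j.+1%:R ^+ 2 * truncate2 N Auv m j.+1
     - 2 * (2 * m + 4 * j + 3)%:R * m.+1%:R * truncate2 N Auv m.+1 j : R[i])
  * nm u ^+ m * nm v ^+ j <= 2 ^+ 18 * N%:R ^+ 2 * 32^-1 ^+ N.
Proof.
move=> hu hv.
have p0 : 0 <= 2 ^+ 18 * N%:R ^+ 2 * 32^-1 ^+ N :> R.
  by rewrite !mulr_ge0 ?exprn_ge0.
rewrite /truncate2; case: ifP => h1.
  rewrite Auv_recr (_ : (m.+1 + j.*2 < N)%N); last by lia.
  by rewrite subrr nm0 !mul0r.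
case: ifP => h2; last by rewrite !mulr0 subr0 nm0 !mul0r.
have NE : N = (m + j.*2).+2 by lia.
move: (Auv m.+1 j) (nm_Auv_le m.+1 j) => c hc; rewrite mulr0 sub0r nmN !nmM !nmn.
have A1 : (2 * m + 4 * j + 3)%:R <= 2 * N%:R :> R by rewrite -natrM ler_nat; lia.
have A2 : m.+1%:R <= N%:R :> R by rewrite ler_nat; lia.
apply: le_trans (_ : (2 * (2 * N%:R) * N%:R * 64) *
   (64 ^+ (m + j.*2) * nm u ^+ m * nm v ^+ j) <= _).
  rewrite !mulrA -(mulrA _ 64) -exprS.
  do 2 (apply: ler_wpM2r; first by rewrite exprn_ge0 ?nm_ge0).
  apply: (ler_pM _ (nm_ge0 _) _ hc); first by rewrite !mulr_ge0.
  rewrite (_ : 2 * 2 * N%:R * N%:R = 2 * (2 * N%:R) * N%:R); last by ring.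
  by apply: ler_pM; rewrite ?mulr_ge0 // ler_pM2l.
apply: le_trans (ler_wpM2l _ (Auv_term_le m j hu hv)) _; first by rewrite !mulr_ge0.
rewrite (_ : 32^-1 ^+ N = 32^-1 * (32^-1 * 32^-1 ^+ (m + j.*2))); last by rewrite -!exprS -NE.
set q := _ ^+ (m + _); have q0 : 0 <= q by rewrite exprn_ge0.
rewrite -subr_ge0 (_ : _ - _ = N%:R ^+ 2 * q * (2 ^+ 18 / 32 / 32 - 256)); last by field.
by rewrite !mulr_ge0 ?exprn_ge0//; lra.
Qed.
End Bounds.

(** * The parametrization and the Gauss series *)

Section Param.
Variable F : numFieldType.
Implicit Types X Y : F.

Definition upar X Y := - ((X - Y) / (4 * (1 + X * Y))) ^+ 2.
(* The suffixes 1 and 2 denote first and second derivatives in X. *)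
Definition upar1 X Y := - ((X - Y) * (1 + Y ^+ 2) / (8 * (1 + X * Y) ^+ 3)).
Definition upar2 X Y :=
  - ((1 + Y ^+ 2) * (1 + X * Y - 3 * Y * (X - Y)) / (8 * (1 + X * Y) ^+ 4)).
(** The value of x^2 = xy ((1 + 4x/y) - 1) / 4, by (X+Y)^2 (1-XY)^2 - (X-Y)^2 (1+XY)^2 = 4XY
    (1-X^2)(1-Y^2). The denominator (X - Y)^2 cancels, so the formula is regular on the diagonal,
    which contains the base point (1, 1). *)
Definition vpar X Y :=
  - (X * Y * (1 - X ^+ 2) * (1 - Y ^+ 2) / (16 * (1 + X * Y) ^+ 4)).
Definition vpar_num X Y := 1 - 3 * X ^+ 2 - 3 * X * Y + X ^+ 3 * Y.
Definition vpar1 X Y :=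
  - (Y * (1 - Y ^+ 2) * vpar_num X Y / (16 * (1 + X * Y) ^+ 5)).
Definition vpar2 X Y :=
  - (Y * (1 - Y ^+ 2) * ((- 6 * X - 3 * Y + 3 * X ^+ 2 * Y) * (1 + X * Y)
     - 5 * Y * vpar_num X Y) / (16 * (1 + X * Y) ^+ 6)).
(* The weights solve the linear system that makes the second-order
   parts of both sides of pde_to_ode agree; they turn out regular at X = Y. *)
Definition weight1 X Y := (X + Y) * (1 - X * Y) / (4 * (1 + X * Y) ^+ 3).
Definition weight2 X Y :=
  ((X + Y) * (1 - X * Y) * ((1 + X * Y) ^+ 2 - (X - Y) ^+ 2)
   - X * (1 - X ^+ 2) * (1 + Y ^+ 2) ^+ 2) / (16 * (1 + X * Y) ^+ 5).

(** [f], [fu], ..., [fvv] are independent symbols for a function and its partial derivatives, so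
    this is an identity of rational functions and applies to truncations unchanged. [S1] and [S2]
    are the X-derivatives of f(u, v) by the chain rule; the left side is L applied to f / s. *)
Lemma pde_to_ode X Y f fu fv fuu fuv fvv : 1 + X * Y != 0 ->
  let u := upar X Y in let v := vpar X Y in let s := 1 + X * Y in
  let S1 := fu * upar1 X Y + fv * vpar1 X Y in
  let S2 := fuu * upar1 X Y ^+ 2 + 2 * fuv * upar1 X Y * vpar1 X Y + fvv * vpar1 X Y ^+ 2
            + fu * upar2 X Y + fv * vpar2 X Y in
  (X ^+ 3 - X) * (S2 / s - 2 * Y * S1 / s ^+ 2 + 2 * Y ^+ 2 * f / s ^+ 3)
    + (3 * X ^+ 2 - 1) * (S1 / s - Y * f / s ^+ 2) + X * (f / s)
  = weight1 X Y * (u * fuu + v * fuv + fu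
      + 4 * (4 * u ^+ 2 * fuu + 12 * u * v * fuv + 8 * v ^+ 2 * fvv
             + 8 * u * fu + 14 * v * fv + f))
  + weight2 X Y * (v * fvv + fv - 4 * u * fuu - 8 * v * fuv - 6 * fu).
Proof.
move=> s0; rewrite /= /weight1 /weight2 /upar /vpar /upar1 /upar2 /vpar1 /vpar2 /vpar_num.
by field.
Qed.

Lemma uparC X Y : upar Y X = upar X Y.
Proof. by rewrite /upar -(opprB X Y) mulNr sqrrN (mulrC Y). Qed.

Lemma vparC X Y : vpar Y X = vpar X Y.
Proof. by rewrite /vpar (mulrC Y) (mulrAC _ (1 - Y ^+ 2)). Qed.
End Param.

(** * Size estimates near X = Y = 1 *)

Section NormBounds.
Variable R : realType.
Implicit Types (a b : R[i]) (A B : R).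

Lemma nmD_le a b A B : nm a <= A -> nm b <= B -> nm (a + b) <= A + B.
Proof. by move=> h1 h2; apply: le_trans (nmD _ _) (lerD h1 h2). Qed.

Lemma nmB_le a b A B : nm a <= A -> nm b <= B -> nm (a - b) <= A + B.
Proof. by move=> h1 h2; apply: nmD_le => //; rewrite nmN. Qed.

Lemma nmM_le a b A B : nm a <= A -> nm b <= B -> nm (a * b) <= A * B.
Proof. by move=> h1 h2; rewrite nmM ler_pM // nm_ge0. Qed.

Lemma nmX_le a A n : nm a <= A -> nm (a ^+ n) <= A ^+ n.
Proof.
move=> h; rewrite nmX lerXn2r // nnegrE; first exact: nm_ge0.
exact: le_trans (nm_ge0 _) h.
Qed.

Lemma nm_div_le a b A B : 0 < B -> nm a <= A -> B <= nm b -> nm (a / b) <= A / B.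
Proof.
move=> B0 h1 h2; rewrite nmM nmV; apply: ler_pM; rewrite ?invr_ge0 ?nm_ge0//.
by rewrite lef_pV2 // posrE ?(lt_le_trans B0).
Qed.

Variables X Y : R[i].
(** The radius makes |X - Y| <= 2^-11, whose square is the 2^-22 that [Auv_term_le] asks of |u|. *)
Let dlt : R := 2^-1 ^+ 12.
Hypothesis hX : nm (X - 1) <= dlt.
Hypothesis hY : nm (Y - 1) <= dlt.
Let dlt4 : dlt <= 4^-1. Proof. rewrite /dlt; lra. Qed.

Lemma near1_le (Z : R[i]) : nm (Z - 1) <= 2^-1 ^+ 12 -> nm Z <= 2.
Proof.
move=> hZ; rewrite -(subrK 1 Z); apply: le_trans (nmD _ _) _; rewrite nm1.
by move: dlt4; rewrite /dlt => ?; lra.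
Qed.

Lemma near1_sqr (Z : R[i]) : nm (Z - 1) <= 2^-1 ^+ 12 ->
  nm (1 - Z ^+ 2) <= 3 * 2^-1 ^+ 12.
Proof.
move=> hZ; rewrite (_ : 1 - Z ^+ 2 = (1 + Z) * - (Z - 1)); last by ring.
apply: nmM_le; last by rewrite nmN.
rewrite (_ : 3 = 1 + 2); last by ring.
by apply: nmD_le (near1_le hZ); rewrite nm1.
Qed.

Lemma near1_den : 1 <= nm (1 + X * Y).
Proof.
have H : nm ((X - 1) * Y + (Y - 1)) <= dlt * 2 + dlt.
  by apply: nmD_le => //; apply: nmM_le => //; exact: near1_le.
have := nmB_le (lexx (nm (1 + X * Y))) H.
rewrite (_ : _ - _ = 2%:R); last by ring.
by rewrite nmn; move: dlt4; lra.
Qed.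

Let nX := near1_le hX.
Let nY := near1_le hY.

Lemma near1_upar : nm (upar X Y) <= 2^-1 ^+ 22.
Proof.
rewrite /upar nmN (_ : 2^-1 ^+ 22 = ((dlt + dlt) / 1) ^+ 2); last first.
  by rewrite /dlt; field.
apply: nmX_le; apply: nm_div_le => //; last first.
  by rewrite nmM nmn; have := near1_den; lra.
by rewrite (_ : X - Y = (X - 1) - (Y - 1)); [exact: nmB_le|ring].
Qed.

Lemma near1_vpar : nm (vpar X Y) <= 2^-1 ^+ 22.
Proof.
rewrite /vpar nmN.
apply: le_trans (_ : (2 * 2 * (3 * dlt) * (3 * dlt)) / 16 <= _).
  apply: nm_div_le => //.
    by apply: nmM_le; [apply: nmM_le; [exact: nmM_le|]|]; exact: near1_sqr.
  by rewrite nmM nmn nmX ler_peMr // exprn_ege1 // near1_den.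
by rewrite /dlt; lra.
Qed.

Let nXY : nm (X * Y) <= 2 * 2. Proof. exact: nmM_le. Qed.

Let n1 : nm (1 : R[i]) <= 1. Proof. by rewrite nm1. Qed.

Let den_ge (c n : nat) : (0 < c)%N -> 1 <= nm (c%:R * (1 + X * Y) ^+ n).
Proof.
move=> c0; rewrite nmM nmn nmX -[leLHS]mulr1.
by apply: ler_pM; rewrite ?ler1n // exprn_ege1 // near1_den.
Qed.

Lemma near1_weight1 : nm (weight1 X Y) <= 20.
Proof.
rewrite (_ : 20 = (2 + 2) * (1 + 2 * 2) / 1); last by field.
apply: nm_div_le; rewrite ?den_ge //.
by apply: nmM_le; [exact: nmD_le|exact: nmB_le].
Qed.

Lemma near1_weight2 : nm (weight2 X Y) <= 2000.
Proof.
apply: le_trans (_ : (((2 + 2) * (1 + 2 * 2) * ((1 + 2 * 2) ^+ 2 + (2 + 2) ^+ 2)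
  + 2 * (1 + 2 ^+ 2) * (1 + 2 ^+ 2) ^+ 2) / 1) <= _); last by lra.
apply: nm_div_le; rewrite ?den_ge //.
apply: nmB_le; apply: nmM_le.
- by apply: nmM_le; [exact: nmD_le|exact: nmB_le].
- by apply: nmB_le; apply: nmX_le; [exact: nmD_le|exact: nmB_le].
- by apply: nmM_le => //; apply: nmD_le; rewrite ?nmN //; exact: nmX_le.
- by apply: nmX_le; apply: nmD_le => //; exact: nmX_le.
Qed.
End NormBounds.

(** * The Gauss series and its truncations *)

Section Gauss.

Definition gauss_coef {F : fieldType} n : F :=
  poch (2%:R^-1) n * poch (2%:R^-1) n / (poch 1 n * (n`!)%:R).

Lemma pochS {F : nzRingType} (a : F) n : poch a n.+1 = poch a n * (a + n%:R).
Proof. by rewrite /poch big_ord_recr. Qed.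

Lemma poch_1 {F : nzRingType} n : poch (1 : F) n = n`!%:R.
Proof.
elim: n => [|n IH]; first by rewrite /poch big_ord0 fact0.
by rewrite pochS IH factS mulnC natrM nat1r.
Qed.

Lemma gauss_coef0 {F : fieldType} : gauss_coef 0 = 1 :> F.
Proof. by rewrite /gauss_coef /poch !big_ord0 fact0 !mulr1 divr1. Qed.

Lemma gauss_coef_rec {F : numFieldType} n :
  n.+1%:R ^+ 2 * gauss_coef n.+1 = (n%:R ^+ 2 + n%:R + 4^-1) * gauss_coef n :> F.
Proof.
rewrite /gauss_coef !poch_1 !pochS factS natrM.
have f0 : n`!%:R != 0 :> F by rewrite pnatr_eq0 -lt0n fact_gt0.
have : n.+1%:R != 0 :> F by rewrite pnatr_eq0.
rewrite -natr1 => s0.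
by field; rewrite f0 s0.
Qed.

Variable R : realType.

Lemma nm_quarter n : nm (n%:R ^+ 2 + n%:R + 4^-1 : R[i]) <= n.+1%:R ^+ 2.
Proof.
apply: le_trans (_ : n%:R ^+ 2 + n%:R + 4^-1 <= _).
  apply: nmD_le; last by rewrite nmV nmn.
  by apply: nmD_le; rewrite ?nmX nmn.
rewrite -[n.+1%:R]natr1; have := ler0n R n; move: (n%:R : R) => x x0.
by rewrite -subr_ge0 (_ : _ - _ = x + 3 / 4); [lra|field].
Qed.

(** The ratio of consecutive coefficients is (n + 1/2)^2 / (n + 1)^2 <= 1. *)
Lemma gauss_coef_le n : nm (gauss_coef n : R[i]) <= 1.
Proof.
elim: n => [|n IH]; first by rewrite gauss_coef0 nm1.
have p : 0 < n.+1%:R ^+ 2 :> R by rewrite exprn_gt0 // ltr0n.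
rewrite -(ler_pM2l p) -{1}(nmn n.+1) -nmX -nmM gauss_coef_rec.
by apply: nmM_le => //; exact: nm_quarter.
Qed.

Definition truncate1 {F : nzRingType} N (a : nat -> F) n := if (n < N)%N then a n else 0.

Lemma geom_sum_le N : \sum_(n < N) (32^-1 : R) ^+ n <= 2.
Proof.
have : \sum_(n < N) (32^-1 : R) ^+ n <= 2 - 2 * 32^-1 ^+ N; last first.
  by have : 0 <= (32^-1 : R) ^+ N; [rewrite exprn_ge0|lra].
elim: N => [|N IH]; first by rewrite big_ord0 expr0; lra.
by rewrite big_ord_recr exprS /=; have : 0 <= (32^-1 : R) ^+ N; [rewrite exprn_ge0|lra].
Qed.

(** The tail after the constant term is at most 1/32 times a geometric sum bounded by 2. This keeps
    g away from 0 uniformly in N, as the division by g in the Wronskian estimate requires. *)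
Lemma gauss_partial_near N (z : R[i]) : (0 < N)%N -> nm z <= 32^-1 ->
  nm (sglsum N (truncate1 N gauss_coef) z - 1) <= 16^-1.
Proof.
case: N => // N _ hz; rewrite /sglsum big_ord_recl /truncate1 /= gauss_coef0 expr0 mulr1.
rewrite addrAC subrr add0r; apply: le_trans (nm_sum _ _ _) _.
apply: le_trans (_ : \sum_(n < N) 32^-1 * 32^-1 ^+ n <= _).
  apply: ler_sum => n _; rewrite nmM -exprS -[leRHS]mul1r.
  rewrite /bump /= !add1n ltnS ltn_ord; apply: ler_pM; rewrite ?nm_ge0 ?gauss_coef_le//.
  exact: nmX_le.
by rewrite -mulr_sumr; have := geom_sum_le N; lra.
Qed.

Lemma gauss_ode_le N (z : R[i]) : nm z <= 32^-1 ->
  nm (sglsum N (fun n => n.+1%:R ^+ 2 * truncate1 N gauss_coef n.+1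
                       - (n%:R ^+ 2 + n%:R + 4^-1) * truncate1 N gauss_coef n) z)
  <= 32 * 2^-1 ^+ N.
Proof.
move=> hz; apply: le_trans (nm_sum _ _ _) _.
have p0 : 0 <= N%:R ^+ 2 * (32 * 32^-1 ^+ N) :> R by rewrite !mulr_ge0 ?exprn_ge0.
apply: le_trans (_ : \sum_(n < N) N%:R ^+ 2 * (32 * 32^-1 ^+ N) <= _); last first.
  rewrite sumr_const card_ord -[leLHS]mulr_natl.
  rewrite [leLHS](_ : _ = 32 * (N%:R ^+ 3 * 32^-1 ^+ N)); last by ring.
  rewrite ler_pM2l //; apply: le_trans (expn4_le R N).
  rewrite ler_wpM2r ?exprn_ge0 // -!natrX ler_nat.
  by case: (N) => // n; rewrite [leqRHS]expnS leq_pmull.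
(* Only n = N - 1 violates the recurrence, because there the coefficient of index n + 1 has been cut
   off. *)
apply: ler_sum => n _; rewrite /truncate1 ltn_ord; case: ifP => [h|/negbT].
  by rewrite gauss_coef_rec subrr mul0r nm0.
rewrite -leqNgt => h; have NE : N = n.+1 by apply/eqP; rewrite eqn_leq h ltn_ord.
rewrite mulr0 sub0r nmM nmN; apply: ler_pM; rewrite ?nm_ge0 //.
  rewrite nmM -[leRHS]mulr1 [in leRHS]NE; apply: ler_pM; rewrite ?nm_ge0 ?gauss_coef_le //.
  exact: nm_quarter.
rewrite (_ : 32 * 32^-1 ^+ N = 32^-1 ^+ n); first exact: nmX_le.
by rewrite [in LHS]NE exprS mulrA divff ?mul1r // pnatr_eq0.
Qed.
End Gauss.

(** * Integration along a segment *)

Section Segment.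
Variables (R : realType) (Y d : R[i]) (N : nat).
Hypothesis hY : nm (Y - 1) <= 2^-1 ^+ 12.
Hypothesis hd : nm d <= 2^-1 ^+ 12.
Hypothesis N0 : (0 < N)%N.

Let X (t : R) : R[i] := 1 + t%:C * d.
Let s t := 1 + X t * Y.
Let u t := upar (X t) Y.
Let v t := vpar (X t) Y.
Let z t := 1 - X t ^+ 2.
Let a : nat -> nat -> R[i] := truncate2 N Auv.
Let b : nat -> R[i] := truncate1 N gauss_coef.
Let P c t := dblsum N c (u t) (v t).

Let hX t : 0 <= t <= 1 -> nm (X t - 1) <= 2^-1 ^+ 12.
Proof.
move=> /andP[t0 t1]; rewrite /X addrAC subrr add0r nmM nmR //.
by apply: le_trans hd; rewrite ler_piMl ?nm_ge0.
Qed.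

Let s0 t : 0 <= t <= 1 -> s t != 0.
Proof.
move=> /hX h; rewrite -nm_eq0; apply: lt0r_neq0.
exact: lt_le_trans ltr01 (near1_den h hY).
Qed.

Let dX t : cderiv X t d.
Proof. exact: cderiv_line. Qed.

Let ds t : cderiv s t (d * Y).
Proof.
apply: cderiv_eq (cderivD (cderiv_cst 1 t) (cderivM (dX t) (cderiv_cst Y t))) _.
by ring.
Qed.

Let du1 t : 0 <= t <= 1 -> cderiv u t (d * upar1 (X t) Y).
Proof.
move=> t01; have st := s0 t01.
have sc : 4 * s t != 0 by rewrite mulf_neq0 // pnatr_eq0.
apply: cderiv_eq (cderivN (cderivX 2 (cderivM (cderivB (dX t) (cderiv_cst Y t))
  (cderivV sc (cderivM (cderiv_cst 4 t) (ds t)))))) _.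
by rewrite /= /upar1 -/(s t); move: st; rewrite /s => st; field.
Qed.

Let dv1 t : 0 <= t <= 1 -> cderiv v t (d * vpar1 (X t) Y).
Proof.
move=> t01; have st := s0 t01.
have sc : 16 * s t ^+ 4 != 0 by rewrite mulf_neq0 ?expf_neq0 // pnatr_eq0.
apply: cderiv_eq (cderivN (cderivM (cderivM (cderivM (cderivM (dX t) (cderiv_cst Y t))
   (cderivB (cderiv_cst 1 t) (cderivX 2 (dX t)))) (cderiv_cst (1 - Y ^+ 2) t))
  (cderivV sc (cderivM (cderiv_cst 16 t) (cderivX 4 (ds t)))))) _.
by rewrite /= /vpar1 /vpar_num; move: st; rewrite /s => st; field.
Qed.

Let du2 t : 0 <= t <= 1 -> cderiv (fun t => upar1 (X t) Y) t (d * upar2 (X t) Y).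
Proof.
move=> t01; have st := s0 t01.
have sc : 8 * s t ^+ 3 != 0 by rewrite mulf_neq0 ?expf_neq0 // pnatr_eq0.
apply: cderiv_eq (cderivN (cderivM (cderivM (cderivB (dX t) (cderiv_cst Y t))
   (cderiv_cst (1 + Y ^+ 2) t))
  (cderivV sc (cderivM (cderiv_cst 8 t) (cderivX 3 (ds t)))))) _.
by rewrite /= /upar2; move: st; rewrite /s => st; field.
Qed.

Let dv2 t : 0 <= t <= 1 -> cderiv (fun t => vpar1 (X t) Y) t (d * vpar2 (X t) Y).
Proof.
move=> t01; have st := s0 t01.
have sc : 16 * s t ^+ 5 != 0 by rewrite mulf_neq0 ?expf_neq0 // pnatr_eq0.
have dp : cderiv (fun t => vpar_num (X t) Y) t
    (d * (- 6 * X t - 3 * Y + 3 * X t ^+ 2 * Y)).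
  apply: cderiv_eq (cderivD (cderivB (cderivB (cderiv_cst 1 t)
    (cderivM (cderiv_cst 3 t) (cderivX 2 (dX t))))
    (cderivM (cderivM (cderiv_cst 3 t) (dX t)) (cderiv_cst Y t)))
    (cderivM (cderivX 3 (dX t)) (cderiv_cst Y t))) _.
  by rewrite /=; ring.
apply: cderiv_eq (cderivN (cderivM (cderivM (cderiv_cst (Y * (1 - Y ^+ 2)) t) dp)
  (cderivV sc (cderivM (cderiv_cst 16 t) (cderivX 5 (ds t)))))) _.
by rewrite /= /vpar2; move: st; rewrite /s => st; field.
Qed.

Let al0 m j : (N <= m)%N -> a m j = 0.
Proof. by move=> h; rewrite /a /truncate2; case: ifP => //; lia. Qed.

Let ar0 m j : (N <= j)%N -> a m j = 0.
Proof. by move=> h; rewrite /a /truncate2; case: ifP => //; lia. Qed.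

Let b0 n : (N <= n)%N -> b n = 0.
Proof. by move=> h; rewrite /b /truncate1; case: ifP => //; lia. Qed.

Let S1 t := P (coef_du a) t * upar1 (X t) Y + P (coef_dv a) t * vpar1 (X t) Y.
Let S2 t := P (coef_du (coef_du a)) t * upar1 (X t) Y ^+ 2
  + 2 * P (coef_du (coef_dv a)) t * upar1 (X t) Y * vpar1 (X t) Y
  + P (coef_dv (coef_dv a)) t * vpar1 (X t) Y ^+ 2
  + P (coef_du a) t * upar2 (X t) Y + P (coef_dv a) t * vpar2 (X t) Y.

Let dP c t : 0 <= t <= 1 -> (forall m j, (N <= m)%N -> c m j = 0) ->
  (forall m j, (N <= j)%N -> c m j = 0) ->
  cderiv (P c) t
    (P (coef_du c) t * (d * upar1 (X t) Y) + P (coef_dv c) t * (d * vpar1 (X t) Y)).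
Proof. by move=> t01 c1 c2; apply: cderiv_dblsum; auto. Qed.

Let dS t : 0 <= t <= 1 -> cderiv (P a) t (d * S1 t).
Proof. by move=> t01; apply: cderiv_eq (dP t01 al0 ar0) _; rewrite /S1; ring. Qed.

Let dS1 t : 0 <= t <= 1 -> cderiv S1 t (d * S2 t).
Proof.
move=> t01.
have c1 : forall m j, (N <= m)%N -> coef_du a m j = 0.
  by move=> m j le_Nm; rewrite /coef_du al0 ?mulr0//; lia.
have c2 : forall m j, (N <= j)%N -> coef_du a m j = 0.
  by move=> m j le_Nj; rewrite /coef_du ar0 ?mulr0//; lia.
have c3 : forall m j, (N <= m)%N -> coef_dv a m j = 0.
  by move=> m j le_Nm; rewrite /coef_dv al0 ?mulr0//; lia.
have c4 : forall m j, (N <= j)%N -> coef_dv a m j = 0.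
  by move=> m j le_Nj; rewrite /coef_dv ar0 ?mulr0//; lia.
apply: cderiv_eq (cderivD (cderivM (dP t01 c1 c2) (du2 t01)) (cderivM (dP t01 c3 c4) (dv2 t01))) _.
(* Equality of mixed partial derivatives: on coefficients two integer factors commute. *)
have -> : P (coef_dv (coef_du a)) t = P (coef_du (coef_dv a)) t.
  by apply: eq_dblsum => m j; rewrite /coef_dv /coef_du !mulrA (mulrC j.+1%:R).
rewrite /S2; move: (P _ t) (P _ t) (P _ t) (P _ t) (P _ t) => p1 p2 p3 p4 p5.
by ring.
Qed.

Let h t := P a t / s t.
Let h1 t := S1 t / s t - Y * P a t / s t ^+ 2.
Let h2 t := S2 t / s t - 2 * Y * S1 t / s t ^+ 2 + 2 * Y ^+ 2 * P a t / s t ^+ 3.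

Let dh t : 0 <= t <= 1 -> cderiv h t (d * h1 t).
Proof.
move=> t01; have st := s0 t01.
apply: cderiv_eq (cderivM (dS t01) (cderivV st (ds t))) _.
by rewrite /h1; move: (S1 t) (P a t) (s t) st => p q r r0; field.
Qed.

Let dh1 t : 0 <= t <= 1 -> cderiv h1 t (d * h2 t).
Proof.
move=> t01; have st := s0 t01; have st2 : s t ^+ 2 != 0 by rewrite expf_neq0.
apply: cderiv_eq (cderivB (cderivM (dS1 t01) (cderivV st (ds t)))
  (cderivM (cderivM (cderiv_cst Y t) (dS t01)) (cderivV st2 (cderivX 2 (ds t))))) _.
by rewrite /h2 /=; move: (S1 t) (S2 t) (P a t) (s t) st {st2} => p p' q r r0; field.
Qed.

Let g t := sglsum N b (z t).
Let g1 t := - 2 * X t * sglsum N (coef_dz b) (z t).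
Let g2 t := - 2 * sglsum N (coef_dz b) (z t)
  + 4 * X t ^+ 2 * sglsum N (coef_dz (coef_dz b)) (z t).

Let dz1 t : cderiv z t (d * (- 2 * X t)).
Proof.
by apply: cderiv_eq (cderivB (cderiv_cst 1 t) (cderivX 2 (dX t))) _; rewrite /=; ring.
Qed.

Let dg t : cderiv g t (d * g1 t).
Proof.
by apply: cderiv_eq (cderiv_sglsum b0 (dz1 t)) _; rewrite /g1; ring.
Qed.

Let dg1 t : cderiv g1 t (d * g2 t).
Proof.
have b1 n : (N <= n)%N -> coef_dz b n = 0 by move=> ?; rewrite /coef_dz b0 ?mulr0//; lia.
apply: cderiv_eq (cderivM (cderivM (cderiv_cst (- 2) t) (dX t))
  (cderiv_sglsum b1 (dz1 t))) _.
by rewrite /g2; ring.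
Qed.

(** One error bound for both equations: the weights give (20 + 2000) * 2^18 <= 2^30 for h, and
    Gauss's equation only needs 2^8 for g. *)
Let e : R := 2 ^+ 30 * 2^-1 ^+ N.

Let pde_le c t : 0 <= t <= 1 ->
  (forall m j, nm (c m j) * nm (u t) ^+ m * nm (v t) ^+ j
     <= 2 ^+ 18 * N%:R ^+ 2 * 32^-1 ^+ N) ->
  nm (P c t) <= 2 ^+ 18 * 2^-1 ^+ N.
Proof.
move=> t01 H; apply: le_trans (nm_dblsum_le (fun m j _ _ => H m j)) _.
rewrite [leLHS](_ : _ = 2 ^+ 18 * (N%:R ^+ 4 * 32^-1 ^+ N)); last by ring.
by rewrite ler_wpM2l ?exprn_ge0 // expn4_le.
Qed.

Let Lh t : 0 <= t <= 1 ->
  nm ((X t ^+ 3 - X t) * h2 t + (3 * X t ^+ 2 - 1) * h1 t + X t * h t) <= e.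
Proof.
move=> t01; have hXt := hX t01.
have hu := near1_upar hXt hY; have hv := near1_vpar hXt hY.
rewrite /h2 /h1 /h pde_to_ode; last exact: s0.
rewrite (dblsum_pde1 _ _ al0 ar0) (dblsum_pde2 _ _ al0 ar0).
rewrite /e.
apply: le_trans (_ : 20 * (2 ^+ 18 * 2^-1 ^+ N) + 2000 * (2 ^+ 18 * 2^-1 ^+ N) <= _).
  apply: nmD_le; apply: nmM_le.
  - exact: near1_weight1.
  - by apply: pde_le => // m j; apply: pde1_coef_le.
  - exact: near1_weight2.
  - by apply: pde_le => // m j; apply: pde2_coef_le.
have : 0 <= (2^-1 : R) ^+ N by rewrite exprn_ge0.
move: ((2^-1 : R) ^+ N) => q q0.
rewrite -subr_ge0 (_ : _ - _ = 2 ^+ 18 * 2076%:R * q); last by ring.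
by apply: mulr_ge0 q0; apply: mulr_ge0; rewrite ?exprn_ge0 ?ler0n.
Qed.

Let zr t : 0 <= t <= 1 -> nm (z t) <= 32^-1.
Proof. by move=> /hX /near1_sqr h'; apply: le_trans h' _; lra. Qed.

Let Lg t : 0 <= t <= 1 ->
  nm ((X t ^+ 3 - X t) * g2 t + (3 * X t ^+ 2 - 1) * g1 t + X t * g t) <= e.
Proof.
(* Under z = 1 - X^2 the operator L is -4X times Gauss's operator in z. *)
move=> t01; rewrite (_ : _ + _ = - 4 * X t *
   (z t * (1 - z t) * sglsum N (coef_dz (coef_dz b)) (z t)
   + (1 - 2 * z t) * sglsum N (coef_dz b) (z t) - 4^-1 * sglsum N b (z t))); last first.
  by rewrite /g2 /g1 /g; move: (sglsum _ _ _) (sglsum _ _ _) (sglsum _ _ _) => x y w;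
    rewrite /z; field.
rewrite (sglsum_ode _ b0).
apply: le_trans (_ : 4 * 2 * (32 * 2^-1 ^+ N) <= _).
  apply: nmM_le; last exact/gauss_ode_le/zr.
  apply: nmM_le; first by rewrite nmN nmn.
  exact/near1_le/hX.
have : 0 <= (2^-1 : R) ^+ N by rewrite exprn_ge0.
rewrite /e; move: ((2^-1 : R) ^+ N) => q q0.
rewrite -subr_ge0 (_ : _ - _ = (2 ^+ 30 - 2 ^+ 8) * q); last by ring.
rewrite mulr_ge0 // subr_ge0 ler_weXn2l //; lra.
Qed.

(** The double sum is dominated by a product of two geometric sums, each at most 2, and |1 + XY| >=
    1. *)
Let hB t : 0 <= t <= 1 -> nm (h t) <= 4.
Proof.
move=> t01; have hXt := hX t01.
have hu := near1_upar hXt hY; have hv := near1_vpar hXt hY.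
rewrite (_ : 4 = 2 * 2 / 1); last by field.
apply: nm_div_le => //; last exact: near1_den.
apply: le_trans (nm_sum _ _ _) _.
apply: le_trans (_ : \sum_(m < N) (32^-1 ^+ m * \sum_(j < N) 32^-1 ^+ j) <= _); last first.
  rewrite -mulr_suml; apply: ler_pM; rewrite ?geom_sum_le //.
    by apply: sumr_ge0 => i _; rewrite exprn_ge0.
  by apply: sumr_ge0 => i _; rewrite exprn_ge0.
apply: ler_sum => m _; rewrite mulr_sumr; apply: le_trans (nm_sum _ _ _) _.
apply: ler_sum => j _; rewrite !nmM !nmX.
apply: le_trans (_ : 32^-1 ^+ (m + j.*2) <= _); last first.
  by rewrite -exprD ler_wiXn2l //; [lra|rewrite leq_add2l; lia].
apply: le_trans (Auv_term_le m j hu hv).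
do 2 (apply: ler_wpM2r; first by rewrite exprn_ge0 ?nm_ge0).
by rewrite /a /truncate2; case: ifP => _; rewrite ?nm0 ?exprn_ge0 ?nm_Auv_le.
Qed.

Let g_near t : 0 <= t <= 1 -> nm (g t - 1) <= 16^-1.
Proof. by move=> t01; apply: gauss_partial_near => //; exact: zr. Qed.

Let g_le t : 0 <= t <= 1 -> nm (g t) <= 2.
Proof.
move=> /g_near H; rewrite -(subrK 1 (g t)); apply: le_trans (nmD _ _) _.
rewrite nm1; lra.
Qed.

Let g_ge t : 0 <= t <= 1 -> 2^-1 <= nm (g t).
Proof.
move=> /g_near H; have := nmB_le (lexx (nm (g t))) H.
rewrite (_ : g t - (g t - 1) = 1) ?nm1; [lra|by ring].
Qed.

(** The segment runs from (1, Y) to (1 + d, Y), and h / g is constant along it up to the truncation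
    error. The constant comes from 4 * 2^30 * (2 + 4) <= 2^35. *)
Lemma segment_bound :
  nm (dblsum N (truncate2 N Auv) (upar (1 + d) Y) (vpar (1 + d) Y) / (1 + (1 + d) * Y)
        / sglsum N (truncate1 N gauss_coef) (1 - (1 + d) ^+ 2)
      - dblsum N (truncate2 N Auv) (upar 1 Y) (vpar 1 Y) / (1 + Y)
        / sglsum N (truncate1 N gauss_coef) 0) <= 2 ^+ 35 * 2^-1 ^+ N.
Proof.
have nd : nm d <= 4^-1 by apply: le_trans hd _; lra.
have := wronskian_bound nd dh dh1 (fun t _ => dg t) (fun t _ => dg1 t) Lh Lg hB g_le g_ge.
rewrite /h /g /P /u /v /s /z /X mul0r mul1r addr0 mul1r expr1n subrr => H.
apply: le_trans H _; rewrite /e.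
have : 0 <= (2^-1 : R) ^+ N by rewrite exprn_ge0.
move: ((2^-1 : R) ^+ N) => q q0.
rewrite -subr_ge0 (_ : _ - _ = 2 ^+ 33 * q); last by ring.
by rewrite mulr_ge0 ?exprn_ge0.
Qed.
End Segment.

(** * Passage to the limit *)

Section Limits.
Local Open Scope classical_set_scope.
Local Open Scope ring_scope.
Variable R : realType.
Implicit Types f : nat -> R[i].

(** The norm of R[i] is R[i]-valued, so its epsilons are positive elements of R[i], which are
    necessarily real; this passes to real epsilons. *)
Lemma cvg_nmP f (l : R[i]) :
  f @ \oo --> l <-> (fun n => nm (l - f n)) @ \oo --> (0 : R).
Proof.
split=> [/cvgrPdist_lt fl|/cvgrPdist_lt fl].
  apply/cvgrPdist_lt => e e0; have ec : 0 < e%:C by rewrite ltcR.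
  apply: filterS (fl _ ec) => n; rewrite nmE ltcR sub0r normrN ger0_norm //.
  exact: nm_ge0.
apply/cvgrPdist_lt => -[e e'] /=; rewrite ltcE /= => /andP[/eqP -> e0].
apply: filterS (fl _ e0) => n; rewrite sub0r normrN ger0_norm ?nm_ge0 // => h.
by rewrite nmE ltcR.
Qed.

Lemma cvg_ReIm f (a b : R) :
  (fun n => complex.Re (f n)) @ \oo --> a -> (fun n => complex.Im (f n)) @ \oo --> b ->
  f @ \oo --> a +i* b.
Proof.
move=> fa fb; apply/cvg_nmP.
apply: (@squeeze_cvgr _ _ _ _ (fun=> 0)
  (fun n => `|a - complex.Re (f n)| + `|b - complex.Im (f n)|)).
- near=> n; rewrite nm_ge0 /=; apply: le_trans (nm_le_ReIm _) _.
  by case: (f n).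
- exact: cvg_cst.
- have H (g : nat -> R) c : g @ \oo --> c -> (fun n => `|c - g n|) @ \oo --> (0 : R).
    move=> gc; rewrite -[X in _ --> X](normr0 R) -(subrr c).
    by apply: cvg_norm; apply: cvgB => //; exact: cvg_cst.
  by rewrite -[X in _ --> X](addr0 (0 : R)); apply: cvgD; apply: H.
Unshelve. all: by end_near. Qed.

(** Completeness is used only in R: the real and imaginary parts converge absolutely by comparison
    with the geometric series. *)
Lemma cvg_geom_dominated f (r : R) : 0 <= r < 1 ->
  (forall n, nm (f n) <= r ^+ n) -> cvgn (series f).
Proof.
move=> /andP[r0 r1] fr.
have H (p : R[i] -> R) : (forall z, `|p z| <= nm z) -> cvgn (series (p \o f)).
  move=> pn; apply: normed_cvg.
  apply: series_le_cvg (@is_cvg_geometric_series R 1 r _) => [n|n|n|] /=.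
  - exact: normr_ge0.
  - by rewrite mul1r exprn_ge0.
  - by rewrite mul1r; apply: le_trans (pn _) (fr n).
  - by rewrite ger0_norm.
have S (p : R[i] -> R) N : (forall x y, p (x + y) = p x + p y) -> p 0 = 0 ->
    p (series f N) = series (p \o f) N.
  by move=> pD p0; rewrite /series /=; apply: (big_morph p pD p0).
have /cvg_ex[a ha] := H _ (@Re_le_nm R).
have /cvg_ex[b hb] := H _ (@Im_le_nm R).
apply/cvg_ex; exists (a +i* b); apply: cvg_ReIm.
- by rewrite (_ : (fun n => _) = series (@complex.Re R \o f)) //;
    apply/funext => n; rewrite S //; exact: ReD.
- by rewrite (_ : (fun n => _) = series (@complex.Im R \o f)) //;
    apply/funext => n; rewrite S //; exact: ImD.
Qed.

Lemma gauss_cvg (z : R[i]) : nm z <= 32^-1 ->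
  (fun N => sglsum N (truncate1 N gauss_coef) z) @ \oo --> hyp2F1 (2%:R^-1) (2%:R^-1) 1 z.
Proof.
move=> hz; rewrite /hyp2F1.
have C : cvgn (series (fun m : nat =>
    poch (2%:R^-1) m * poch (2%:R^-1) m / (poch 1 m * (m`!)%:R) * z ^+ m)).
  apply: (@cvg_geom_dominated _ (32^-1)) => [|n]; first by apply/andP; split; lra.
  rewrite -[leRHS]mul1r; apply: nmM_le; first exact: gauss_coef_le.
  exact: nmX_le.
rewrite (_ : (fun N => _) = series (fun m : nat =>
    poch (2%:R^-1) m * poch (2%:R^-1) m / (poch 1 m * (m`!)%:R) * z ^+ m)) //.
apply/funext => N; rewrite /series /= big_mkord; apply: eq_bigr => i _.
by rewrite /truncate1 ltn_ord.
Qed.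
End Limits.

(** * The product formula from two segments *)

Section Product.
Local Open Scope classical_set_scope.
Local Open Scope ring_scope.
Variables (R : realType) (X Y : R[i]).
Hypothesis hX : nm (X - 1) <= 2^-1 ^+ 12.
Hypothesis hY : nm (Y - 1) <= 2^-1 ^+ 12.
Let A N := dblsum N (truncate2 N Auv) (upar X Y) (vpar X Y) : R[i].
Let G N z := sglsum N (truncate1 N gauss_coef) z : R[i].

(** One segment joins (1, 1) to (1, Y), the other (1, Y) to (X, Y), each with error 2^35 * 2^-N.
    Clearing the denominators multiplies this by at most (1 + 4)(2 + 4) = 30 <= 2^5. *)
Lemma partial_product_le N : (0 < N)%N ->
  nm (A N - (1 + X * Y) / 2 * G N (1 - X ^+ 2) * G N (1 - Y ^+ 2))
  <= 2 ^+ 40 * 2^-1 ^+ N.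
Proof.
move=> N0.
have G0 : G N 0 = 1.
  case: N N0 => // N _; rewrite /G /sglsum big_ord_recl expr0 /truncate1 gauss_coef0 mulr1.
  by rewrite big1 ?addr0 // => i _; rewrite expr0n mulr0.
have C0 : dblsum N (truncate2 N Auv) 0 0 = 1 :> R[i].
  case: N N0 {G0} => // N _; rewrite /dblsum big_ord_recl big_ord_recl.
  rewrite !big1 ?addr0 => [|m _|j _].
  - by rewrite /truncate2 /= /Auv /Acoef /= !expr0 !mulr1.
  - by apply: big1 => j _; rewrite expr0n mulr0 mul0r.
  - by rewrite (expr0n _ (lift _ _)) mulr0.
have := segment_bound hY hX N0; have := @segment_bound R 1 (Y - 1) N.
rewrite subrr nm0 exprn_ge0 // => /(_ isT hY N0).
rewrite !(addrC 1 (_ - 1)) !subrK -![sglsum _ _ _]/(G N _) G0 !divr1 !mulr1.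
(* Symmetry in X and Y makes the base value of the first path the end value of
   the second one. *)
rewrite (uparC 1 Y) (vparC 1 Y) -/(A N).
rewrite [upar 1 1](_ : _ = 0); last by rewrite /upar subrr mul0r expr0n oppr0.
rewrite [vpar 1 1](_ : _ = 0); last by rewrite /vpar !expr1n subrr mulr0 !mul0r oppr0.
rewrite C0.
set B := dblsum N _ _ _.
have s0 : 1 + X * Y != 0.
  by rewrite -nm_eq0; apply: lt0r_neq0; apply: lt_le_trans (near1_den hX hY).
have sY : 1 + Y != 0.
  have := @near1_den _ 1 Y; rewrite subrr nm0 mul1r exprn_ge0 // => /(_ isT hY) h.
  by rewrite -nm_eq0; apply: lt0r_neq0; apply: lt_le_trans h.
have HG Z : nm (Z - 1) <= 2^-1 ^+ 12 ->
    nm (G N (1 - Z ^+ 2)) <= 2 /\ G N (1 - Z ^+ 2) != 0.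
  move=> hZ; have : nm (G N (1 - Z ^+ 2) - 1) <= 16^-1.
    by apply: gauss_partial_near => //; apply: le_trans (near1_sqr hZ) _; lra.
  move=> H; split.
    rewrite -(subrK 1 (G _ _)); apply: le_trans (nmD _ _) _; rewrite nm1; lra.
  apply/eqP => E; move: H; rewrite E sub0r nmN nm1; lra.
have [gX gX0] := HG _ hX; have [gY gY0] := HG _ hY.
set K := 2 ^+ 35 * _ => h2 h1.
move: gX gX0 gY gY0 h1 h2; set p := G N _; set q := G N _ => gX gX0 gY gY0 h1 h2.
(* Telescoping through B / (1 + Y), the value of h at (1, Y); [1 / (1 + 1)] is its value at (1, 1),
   the source of the 1/2 in the formula. *)
have -> : A N - (1 + X * Y) / 2 * p * q =
    (1 + X * Y) * (p * (A N / (1 + X * Y) / p - B / (1 + Y))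
      + p * q * (B / (1 + Y) / q - 1 / (1 + 1))) by field; rewrite s0 sY gX0 gY0.
apply: le_trans (_ : (1 + 2 * 2) * (2 * K + 2 * 2 * K) <= _).
  apply: nmM_le.
    apply: nmD_le; first by rewrite nm1.
    by apply: nmM_le; apply: near1_le.
  exact: nmD_le (nmM_le gX h1) (nmM_le (nmM_le gX gY) h2).
rewrite /K; have : 0 <= (2^-1 : R) ^+ N by rewrite exprn_ge0.
move: ((2^-1 : R) ^+ N) => r r0.
rewrite -subr_ge0 (_ : _ - _ = 2 ^+ 36 * r); last by ring.
by rewrite mulr_ge0 ?exprn_ge0.
Qed.

Lemma Aser_param_cvg : A @ \oo -->
  (1 + X * Y) / 2 * hyp2F1 (2%:R^-1) (2%:R^-1) 1 (1 - X ^+ 2)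
    * hyp2F1 (2%:R^-1) (2%:R^-1) 1 (1 - Y ^+ 2).
Proof.
have small Z : nm (Z - 1) <= 2^-1 ^+ 12 -> nm (1 - Z ^+ 2) <= 32^-1 :> R.
  by move=> hZ; apply: le_trans (near1_sqr hZ) _; lra.
pose D N := A N - (1 + X * Y) / 2 * G N (1 - X ^+ 2) * G N (1 - Y ^+ 2).
have D0 : D @ \oo --> (0 : R[i]).
  apply/cvg_nmP.
  apply: (@squeeze_cvgr _ _ _ _ (fun=> 0) (geometric (2 ^+ 40) (2^-1 : R))).
  - near=> N; rewrite nm_ge0 /= sub0r nmN; apply: partial_product_le.
    by near: N; exact: nbhs_infty_gt.
  - exact: cvg_cst.
  - by apply: cvg_geometric; rewrite ger0_norm //; lra.
pose c : R[i] := (1 + X * Y) / 2.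
have gX := gauss_cvg (small _ hX); have gY := gauss_cvg (small _ hY).
have := cvgD D0 (cvgM (cvgM (cvg_cst c) gX) gY).
rewrite add0r; set f := (X in X @ _) => H.
have -> : A = f by apply/funext => N; rewrite -[RHS]/(D N + c * G N _ * G N _) subrK.
exact: H.
Unshelve. all: by end_near. Qed.
End Product.

Unset Implicit Arguments.

Theorem theorem2p3 (R : realType) :
  exists U : set R[i], nbhs (1 : R[i]) U /\
  forall x y X Y : R[i],
    y != 0 ->
    A_abs_conv x y ->
    X \in U -> Y \in U -> X != Y ->
    - (x * y) = ((X - Y) / (4%:R * (1 + X * Y))) ^+ 2 ->
    1 + 4%:R * x / y =
      (((X + Y) * (1 - X * Y)) / ((X - Y) * (1 + X * Y))) ^+ 2 ->
    Aser x y =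
      (1 + X * Y) / 2%:R
      * hyp2F1 (2%:R^-1) (2%:R^-1) 1 (1 - X ^+ 2)
      * hyp2F1 (2%:R^-1) (2%:R^-1) 1 (1 - Y ^+ 2).
Proof.
exists [set Z : R[i] | nm (Z - 1) <= 2^-1 ^+ 12]%classic; split.
  apply/nbhs_ballP; exists ((2^-1 ^+ 12 : R)%:C).
    by rewrite /= ltcR exprn_gt0.
  move=> Z; rewrite -ball_normE /= nmE ltcR -nmN opprB; exact: ltW.
move=> x y X Y y0 _ /set_mem /= hX /set_mem /= hY XY exy exy'.
have s0 : 1 + X * Y != 0.
  by rewrite -nm_eq0; apply: lt0r_neq0; apply: lt_le_trans (near1_den hX hY).
have XY0 : X - Y != 0 by rewrite subr_eq0.
have hu : x * y = upar X Y by rewrite /upar -exy opprK.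
have hv : x ^+ 2 = vpar X Y.
  (* The second relation is solved for 4x / y. Its right side has X - Y in the denominator, which is
     where X and Y being distinct enters. *)
  have -> : x ^+ 2 = x * y * ((1 + 4%:R * x / y - 1) / 4) by field.
  by rewrite exy' hu /upar /vpar; field; rewrite s0 XY0.
apply: cvg_lim; first exact: norm_hausdorff.
rewrite (_ : series _ = (fun N => dblsum N (truncate2 N Auv) (upar X Y) (vpar X Y))).
  exact: Aser_param_cvg.
by apply/funext => N; rewrite -hu -hv; exact: Aser_partial.
Qed.
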